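(* Let $\delta_B,\delta_R\ge1$ be integers, let $T_0(\lambda)$ be the matrix defined in the context, and let \[\sigma_1=\{\lambda\in\mathbb C:\ T_0(\lambda)\text{ has an eigenvalue of modulus }(\delta_R\delta_B)^{-1/2}\}\] (which is a subset of $[0,\infty)$). Then the eigenvalues $\mu^\pm(\lambda)$ of $T_0(\lambda)$ may be chosen to be single valued analytic functions on $\mathbb C\setminus\sigma_1$ satisfying, as $\lambda\to-\infty$ along the real axis, \[e^{-2|\operatorname{Im}\sqrt\lambda|}\mu^+(\lambda)\to\frac{\delta_R+1}{2\delta_R}\cdot\frac{\delta_B+1}{2\delta_B},\qquad e^{2|\operatorname{Im}\sqrt\lambda|}\mu^-(\lambda)\to\frac{2}{\delta_R+1}\cdot\frac{2}{\delta_B+1}.\] On $\mathbb C\setminus\sigma_1$ one has $|\mu^+(\lambda)|>1/\sqrt{\delta_R\delta_B}$ and $|\mu^-(\lambda)|<1/\sqrt{\delta_R\delta_B}$. The functions $\mu^+$ and $\mu^-$ have continuous extensions to the real axis from the upper and from the lower half planes, which are analytic except on the discrete set where $(\operatorname{tr}T_0(\lambda))^2=4/(\delta_R\delta_B)$. If $\nu\in\sigma_1$ then \[\lim_{\epsilon\to0^+}\bigl(\mu^\pm(\nu+i\epsilon)-\mu^\pm(\nu-i\epsilon)\bigr)=2i\,\operatorname{Im}(\mu^\pm(\nu)),\] where $\mu^\pm(\nu)$ on the right denotes the boundary value $\lim_{\epsilon\to0^+}\mu^\pm(\nu+i\epsilon)$.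
   Context: With $\omega=\sqrt\lambda$, define the entire functions $c(\lambda)=\cos\omega$, $c'(\lambda)=-\omega\sin\omega$, $s(\lambda)=\sin\omega/\omega$, $s'(\lambda)=\cos\omega$. Let $M_0=\begin{pmatrix}c&s\\c'&s'\end{pmatrix}$, $J_B=\operatorname{diag}(1,1/\delta_B)$, $J_R=\operatorname{diag}(1,1/\delta_R)$, and $T_0(\lambda)=J_RM_0J_BM_0$. Then $\det T_0(\lambda)=1/(\delta_B\delta_R)$ and $\operatorname{tr}T_0(\lambda)=\cos^2\omega(1+\frac1{\delta_B\delta_R})-\sin^2\omega(\frac1{\delta_R}+\frac1{\delta_B})$; the eigenvalues are $\mu^\pm=\frac12\operatorname{tr}T_0\pm\sqrt{\frac14(\operatorname{tr}T_0)^2-\det T_0}$, and $\mu^+\mu^-=1/(\delta_B\delta_R)$. *)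

(* Defs.v *)
From Stdlib Require Import Reals.
From Coquelicot Require Import Coquelicot.
Open Scope R_scope.

Definition Cexp (z : C) : C :=
  (exp (Re z) * cos (Im z), exp (Re z) * sin (Im z)).
Definition Ccos (z : C) : C := ((Cexp (Ci * z) + Cexp (- (Ci * z))) / RtoC 2)%C.
Definition Csin (z : C) : C := ((Cexp (Ci * z) - Cexp (- (Ci * z))) / (RtoC 2 * Ci))%C.

(** Principal square root (any branch gives the same c, s, c', s',
    and the same |Im sqrt lambda|). *)
Definition Csqrt (z : C) : C :=
  (sqrt ((Cmod z + Re z) / 2),
   (if Rlt_dec (Im z) 0 then -1 else 1) * sqrt ((Cmod z - Re z) / 2)).

(** c, c', s, s' with omega = sqrt lambda; s is extended by s(0) = 1 (entire). *)
Definition c_fun (l : C) : C := Ccos (Csqrt l).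
Definition c'_fun (l : C) : C := (- (Csqrt l * Csin (Csqrt l)))%C.
Definition s_fun (l : C) : C :=
  if Ceq_dec l (RtoC 0) then RtoC 1 else (Csin (Csqrt l) / Csqrt l)%C.
Definition s'_fun (l : C) : C := Ccos (Csqrt l).

(** 2x2 complex matrices ((a, b), (c, d)) = [[a, b], [c, d]]. *)
Definition M2 : Type := ((C * C) * (C * C))%type.
Definition mk2 (a b c d : C) : M2 := ((a, b), (c, d)).
Definition mul2 (A B : M2) : M2 :=
  let '((a, b), (c, d)) := A in
  let '((e, f), (g, h)) := B in
  mk2 (a * e + b * g)%C (a * f + b * h)%C (c * e + d * g)%C (c * f + d * h)%C.
Definition tr2 (A : M2) : C := let '((a, _), (_, d)) := A in (a + d)%C.
Definition det2 (A : M2) : C := let '((a, b), (c, d)) := A in (a * d - b * c)%C.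
Definition app2 (A : M2) (v : C * C) : C * C :=
  let '((a, b), (c, d)) := A in let '(x, y) := v in ((a * x + b * y)%C, (c * x + d * y)%C).

Definition is_eigenvalue (A : M2) (mu : C) : Prop :=
  exists v : C * C, v <> (RtoC 0, RtoC 0) /\
    app2 A v = ((mu * fst v)%C, (mu * snd v)%C).

Definition M0 (l : C) : M2 := mk2 (c_fun l) (s_fun l) (c'_fun l) (s'_fun l).
Definition Jmat (d : nat) : M2 := mk2 (RtoC 1) (RtoC 0) (RtoC 0) (RtoC (/ INR d)).

Definition T0 (dB dR : nat) (l : C) : M2 :=
  mul2 (Jmat dR) (mul2 (M0 l) (mul2 (Jmat dB) (M0 l))).

Definition sigma1 (dB dR : nat) (l : C) : Prop :=
  exists mu, is_eigenvalue (T0 dB dR l) mu /\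
    Cmod mu = / sqrt (INR dR * INR dB).

Definition C_holo_at (f : C -> C) (z : C) : Prop :=
  @ex_derive C_AbsRing C_NormedModule f z.

Definition Dset (dB dR : nat) (x : R) : Prop :=
  (tr2 (T0 dB dR (RtoC x)) * tr2 (T0 dB dR (RtoC x)))%C = RtoC (4 / (INR dR * INR dB)).

Definition half_ext (up : bool) (f : C -> C) (b : R -> C) (z : C) : C :=
  if up then (if Rlt_dec 0 (Im z) then f z else b (Re z))
  else (if Rlt_dec (Im z) 0 then f z else b (Re z)).
Definition closed_half (up : bool) (z : C) : Prop :=
  if up then 0 <= Im z else Im z <= 0.

(** b is the boundary value of f from the half-plane, and the resulting
    extension is continuous on the closed half-plane and analytic (extends
    holomorphically across the real axis) at every real point outside Dset *)
Definition good_boundary (dB dR : nat) (up : bool) (f : C -> C) (b : R -> C) : Prop :=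
  (forall z, closed_half up z ->
     filterlim (half_ext up f b) (within (closed_half up) (locally z))
       (locally (half_ext up f b z))) /\
  (forall x : R, ~ Dset dB dR x ->
     exists r : R, 0 < r /\ exists g : C -> C,
       (forall z, Cmod (z - RtoC x) < r -> C_holo_at g z) /\
       (forall z, Cmod (z - RtoC x) < r -> closed_half up z -> g z = half_ext up f b z)).

(* Main.v *)
Require Import Defs.
From Stdlib Require Import Reals Lra Psatz.
From Coquelicot Require Import Coquelicot.
Open Scope R_scope.

(** Put [p = 1 / sqrt (dR dB)].  Then [det T0 = p^2] and [tr T0 = 2 p tau] with
    [tau = A + B cos (2 w)], [w = sqrt l], an entire function of [l].  The
    eigenvalues are [p] times the roots of [u^2 - 2 tau u + 1], whose product
    is 1, and a root has modulus 1 iff [tau] lies in [[-1, 1]].  Since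
    [A + B >= 1] and [B - A >= 1], this forces [cos (2 w)] into [[-1, 1]], hence
    [l >= 0].  Off [sigma_1] the root of modulus [> 1] is unique, so it agrees
    with every local branch [tau + sqrt (tau^2 - 1)] of modulus [> 1] and is
    analytic; this gives [mu+], and [mu- = tr T0 - mu+].  At a real point with
    [-1 < tau < 1] one has [sin (2 w) <> 0], and
    [Im tau = - B sin (2 Re w) sinh (2 Im w)] has a constant sign on each side,
    which selects one of the two analytic branches.  Where [tau^2 = 1], the
    identity [|u - tau|^2 = |tau^2 - 1|] gives continuity. *)

(** No single formula for the root is continuous where it is needed: [outer_root] is built from
    [Csqrt], which jumps across its cut, and it tells the two roots apart by modulus, which fails
    where [tau] lies in [-1, 1], since there both roots have modulus 1. So the boundary values are
    written down separately in [boundary_root], with an explicit sign that depends on the side. The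
    bridge between the two descriptions is [Cmod_root_gt]: if q^2 = t^2 - 1 and the imaginary parts
    of q and t have the same strict sign, then t + q is the root of modulus above 1. A local
    analytic square root whose value at the real point is prescribed ([Cholo_local_sqrt]) then
    agrees with [outer_root] inside the half-plane and with [boundary_root] on the axis, and this
    common branch is the analytic extension. The limit of mu- is taken from the product of the
    roots, because as a difference tr T0 - mu+ it is a small remainder of two exponentially large
    terms. *)

(** * Neighbourhoods and continuity in terms of discs *)

Definition near (z : C) (P : C -> Prop) : Prop :=
  exists d, 0 < d /\ forall y, Cmod (y - z) < d -> P y.

Lemma near_and z P Q : near z P -> near z Q -> near z (fun y => P y /\ Q y).
Proof.
  intros [d [hd hP]] [e [he hQ]]; exists (Rmin d e); split.
  - now apply Rmin_pos.
  - intros y hy; pose proof (Rmin_l d e); pose proof (Rmin_r d e).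
    split; [apply hP | apply hQ]; lra.
Qed.

Lemma near_imp (P Q : C -> Prop) z : (forall y, P y -> Q y) -> near z P -> near z Q.
Proof. intros h [d [hd hP]]; exists d; split; auto. Qed.

Lemma near_at z P : near z P -> P z.
Proof.
  intros [d [hd hP]]; apply hP.
  replace (z - z)%C with (RtoC 0) by ring; now rewrite Cmod_0.
Qed.

Lemma near_near z P : near z P -> near z (fun y => near y P).
Proof.
  intros [d [hd hP]]; exists d; split; [easy|]; intros y hy.
  exists (d - Cmod (y - z)); split; [lra|]; intros w hw; apply hP.
  replace (w - z)%C with ((w - y) + (y - z))%C by ring.
  pose proof (Cmod_triangle (w - y) (y - z)); lra.
Qed.

(** The uniform structure of [C] is that of a product, so its balls are squares; the factor [sqrt 2]
    compares them with the discs of [near]. *)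
Lemma near_locally (z : C) P : near z P <-> @locally C_UniformSpace z P.
Proof.
  split.
  - intros [d [hd hP]].
    assert (h2 : 0 < sqrt 2) by (apply sqrt_lt_R0; lra).
    assert (h : 0 < d / sqrt 2) by now apply Rdiv_lt_0_compat.
    exists (mkposreal _ h); intros y hy; apply hP.
    apply (C_NormedModule_mixin_compat2 z y) in hy; simpl in hy.
    replace (sqrt 2 * (d / sqrt 2)) with d in hy by (field; lra).
    exact hy.
  - intros [[d hd] hP]; exists d; split; [easy|]; intros y hy; apply hP.
    now apply C_NormedModule_mixin_compat1.
Qed.

Definition Ccont (f : C -> C) (z : C) : Prop :=
  forall eps, 0 < eps -> near z (fun y => Cmod (f y - f z) < eps).

Lemma Ccont_near (f : C -> C) z P : Ccont f z -> near (f z) P -> near z (fun y => P (f y)).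
Proof.
  intros hf [d [hd hP]]; apply (near_imp _ _ _ (fun y h => hP (f y) h)); auto.
Qed.

Lemma Ccont_const c z : Ccont (fun _ => c) z.
Proof.
  intros e he; exists 1; split; [lra|]; intros y _.
  replace (c - c)%C with (RtoC 0) by ring; now rewrite Cmod_0.
Qed.

Lemma Ccont_id z : Ccont (fun y => y) z.
Proof. intros e he; now exists e. Qed.

Lemma Ccont_plus f g z : Ccont f z -> Ccont g z -> Ccont (fun y => f y + g y)%C z.
Proof.
  intros hf hg e he.
  refine (near_imp _ _ _ _ (near_and _ _ _ (hf (e / 2) _) (hg (e / 2) _))); try lra.
  intros y [h1 h2].
  replace (f y + g y - (f z + g z))%C with ((f y - f z) + (g y - g z))%C by ring.
  pose proof (Cmod_triangle (f y - f z) (g y - g z)); lra.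
Qed.

Lemma Ccont_mult f g z : Ccont f z -> Ccont g z -> Ccont (fun y => f y * g y)%C z.
Proof.
  intros hf hg e he.
  set (a := Cmod (f z)); set (b := Cmod (g z)).
  assert (ha : 0 <= a) by apply Cmod_ge_0.
  assert (hb : 0 <= b) by apply Cmod_ge_0.
  (* The increment of the product is at most k^2 + k b + a k. The summand [e] in the denominator
     gives k < 1, so this is at most k (a + b + 1) = e - k e < e. *)
  set (k := e / (a + b + 1 + e)).
  assert (hk : 0 < k) by (apply Rdiv_lt_0_compat; lra).
  assert (hk1 : k * (a + b + 1 + e) = e) by (unfold k; field; lra).
  assert (hk2 : k < 1) by nra.
  refine (near_imp _ _ _ _ (near_and _ _ _ (hf k hk) (hg k hk))).
  intros y [h1 h2].
  replace (f y * g y - f z * g z)%C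
    with ((f y - f z) * (g y - g z) + ((f y - f z) * g z + f z * (g y - g z)))%C by ring.
  pose proof (Cmod_triangle ((f y - f z) * (g y - g z)) ((f y - f z) * g z + f z * (g y - g z))) as t1.
  pose proof (Cmod_triangle ((f y - f z) * g z) (f z * (g y - g z))) as t2.
  rewrite Cmod_mult in t1; rewrite (Cmod_mult _ (g z)), (Cmod_mult (f z)) in t2; fold a b in t2.
  pose proof (Cmod_ge_0 (f y - f z)); pose proof (Cmod_ge_0 (g y - g z)).
  assert (Cmod (f y - f z) * Cmod (g y - g z) <= k) by nra.
  assert (Cmod (f y - f z) * b <= k * b) by nra.
  assert (a * Cmod (g y - g z) <= a * k) by nra.
  assert (0 < k * e) by nra.
  lra.
Qed.

Lemma Ccont_comp f g z : Ccont f (g z) -> Ccont g z -> Ccont (fun y => f (g y)) z.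
Proof. intros hf hg e he; exact (Ccont_near g z _ hg (hf e he)). Qed.

Lemma Ccont_inv z : z <> RtoC 0 -> Ccont Cinv z.
Proof.
  intros hz e he; pose proof (proj1 (Cmod_gt_0 z) hz) as m.
  set (a := Cmod z) in *.
  (* The first radius keeps |y| above a/2; the second then makes |y - z| / (|y| a) smaller than
     e. *)
  exists (Rmin (a / 2) (e * (a * a) / 2)).
  assert (h : 0 < e * (a * a)) by (repeat apply Rmult_lt_0_compat; lra).
  split; [apply Rmin_pos; lra|]; intros y hy.
  pose proof (Rmin_l (a / 2) (e * (a * a) / 2)); pose proof (Rmin_r (a / 2) (e * (a * a) / 2)).
  pose proof (Cmod_triangle (z - y) y) as t.
  replace (z - y + y)%C with z in t by ring; fold a in t.
  replace (z - y)%C with (- (y - z))%C in t by ring; rewrite Cmod_opp in t.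
  assert (hy0 : y <> RtoC 0) by (apply Cmod_gt_0; lra).
  replace (/ y - / z)%C with (- (y - z) / (y * z))%C by (field; auto).
  rewrite Cmod_div by (now apply Cmult_neq_0).
  rewrite Cmod_opp, Cmod_mult; fold a.
  assert (0 < Cmod y * a) by nra.
  apply Rlt_div_l; [easy|]. nra.
Qed.

(** * Complex differentiability and its calculus rules *)

(* Caratheodory's form of complex differentiability: the difference quotient
   extends continuously, so the calculus rules reduce to continuity rules. *)
Definition Cholo (f : C -> C) (z : C) : Prop :=
  exists phi, Ccont phi z /\ near z (fun y => f y - f z = phi y * (y - z))%C.

Lemma Cholo_cont f z : Cholo f z -> Ccont f z.
Proof.
  intros [phi [hc h]] e he.
  assert (k : Ccont (fun y => phi y * (y + - z))%C z).
  { apply Ccont_mult; [easy|].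
    apply (Ccont_plus (fun y => y)); [apply Ccont_id | apply Ccont_const]. }
  refine (near_imp _ _ _ _ (near_and _ _ _ h (k e he))); intros y [h1 h2].
  rewrite h1.
  replace (phi y * (y - z))%C with (phi y * (y + - z) - phi z * (z + - z))%C by ring.
  exact h2.
Qed.

Lemma Cholo_ext f g z : near z (fun y => f y = g y) -> Cholo f z -> Cholo g z.
Proof.
  intros he [phi [hc h]]; exists phi; split; [easy|].
  pose proof (near_at _ _ he) as hz; simpl in hz.
  refine (near_imp _ _ _ _ (near_and _ _ _ he h)); intros y [h1 h2].
  now rewrite <- h1, <- hz.
Qed.

Lemma Cholo_const c z : Cholo (fun _ => c) z.
Proof.
  exists (fun _ => RtoC 0); split; [apply Ccont_const|].
  exists 1; split; [lra|]; intros; ring.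
Qed.

Lemma Cholo_id z : Cholo (fun y => y) z.
Proof.
  exists (fun _ => RtoC 1); split; [apply Ccont_const|].
  exists 1; split; [lra|]; intros; ring.
Qed.

Lemma Cholo_plus f g z : Cholo f z -> Cholo g z -> Cholo (fun y => f y + g y)%C z.
Proof.
  intros [p [hp h]] [q [hq k]]; exists (fun y => p y + q y)%C.
  split; [now apply Ccont_plus|].
  refine (near_imp _ _ _ _ (near_and _ _ _ h k)); intros y [h1 h2].
  replace (f y + g y - (f z + g z))%C with ((f y - f z) + (g y - g z))%C by ring.
  rewrite h1, h2; ring.
Qed.

Lemma Cholo_mult f g z : Cholo f z -> Cholo g z -> Cholo (fun y => f y * g y)%C z.
Proof.
  intros [p [hp h]] Hg; pose proof (Cholo_cont _ _ Hg) as hc; destruct Hg as [q [hq k]].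
  exists (fun y => p y * g y + f z * q y)%C; split.
  - apply Ccont_plus; apply Ccont_mult; auto; apply Ccont_const.
  - refine (near_imp _ _ _ _ (near_and _ _ _ h k)); intros y [h1 h2].
    replace (f y * g y - f z * g z)%C with ((f y - f z) * g y + f z * (g y - g z))%C by ring.
    rewrite h1, h2; ring.
Qed.

Lemma Cholo_scal c f z : Cholo f z -> Cholo (fun y => c * f y)%C z.
Proof. intros h; apply Cholo_mult; [apply Cholo_const | easy]. Qed.

Lemma Cholo_opp f z : Cholo f z -> Cholo (fun y => - f y)%C z.
Proof.
  intros h; apply (Cholo_ext (fun y => (- RtoC 1) * f y)%C).
  - exists 1; split; [lra|]; intros; ring.
  - now apply Cholo_scal.
Qed.

Lemma Cholo_comp f g z : Cholo f (g z) -> Cholo g z -> Cholo (fun y => f (g y)) z.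
Proof.
  intros [p [hp h]] Hg; pose proof (Cholo_cont _ _ Hg) as hc; destruct Hg as [q [hq k]].
  exists (fun y => p (g y) * q y)%C; split.
  - apply Ccont_mult; [now apply Ccont_comp | easy].
  - refine (near_imp _ _ _ _ (near_and _ _ _ (Ccont_near _ _ _ hc h) k)); intros y [h1 h2].
    rewrite h1, h2; ring.
Qed.

Lemma Cholo_C_holo_at f z : Cholo f z <-> C_holo_at f z.
Proof.
  split.
  - intros [phi [hc h]]; exists (phi z).
    split; [apply is_linear_scal_l|].
    intros x hx.
    apply (@is_filter_lim_locally_unique C_AbsRing (AbsRing_NormedModule C_AbsRing)) in hx.
    subst x.
    intros [e he].
    destruct (near_and _ _ _ h (hc e he)) as [d [hd k]].
    exists (mkposreal d hd); intros y hy; destruct (k y hy) as [k1 k2].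
    change (Cmod ((f y - f z) - (y - z) * phi z) <= e * Cmod (y - z)).
    rewrite k1.
    replace (phi y * (y - z) - (y - z) * phi z)%C with ((phi y - phi z) * (y - z))%C by ring.
    rewrite Cmod_mult; pose proof (Cmod_ge_0 (y - z)); nra.
  - intros [l [_ h]].
    specialize (h z (fun P hP => hP)).
    exists (fun y => if Ceq_dec y z then l else ((f y - f z) / (y - z))%C); split.
    (* The derivative gives a non-strict estimate, while [Ccont] asks for a strict one; hence
       e/2. *)
    + intros e he; assert (he2 : 0 < e / 2) by lra.
      destruct (h (mkposreal _ he2)) as [[d hd] k]; exists d; split; [easy|]; intros y hy.
      destruct (Ceq_dec z z) as [_|n]; [|easy].
      destruct (Ceq_dec y z) as [_|n].
      { replace (l - l)%C with (RtoC 0) by ring; now rewrite Cmod_0. }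
      specialize (k y hy).
      change (Cmod ((f y - f z) - (y - z) * l) <= e / 2 * Cmod (y - z)) in k.
      apply Cminus_eq_contra in n; pose proof (proj1 (Cmod_gt_0 _) n).
      replace ((f y - f z) / (y - z) - l)%C
        with (((f y - f z) - (y - z) * l) / (y - z))%C by (field; easy).
      rewrite Cmod_div by easy; apply Rlt_div_l; nra.
    + exists 1; split; [lra|]; intros y _.
      destruct (Ceq_dec y z) as [->|n]; [ring|].
      apply Cminus_eq_contra in n; now field.
Qed.

(** * The principal square root and local analytic branches *)

Lemma Csqrt_Re_nonneg z : 0 <= Re (Csqrt z).
Proof. apply sqrt_pos. Qed.

(** With m = |z|, the two coordinates have squares (m + x)/2 and (m - x)/2, whose difference is x;
    their product is |y|/2 because m^2 - x^2 = y^2. The sign in [Csqrt] turns |y| into y. *)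
Lemma Csqrt_sqr z : (Csqrt z * Csqrt z)%C = z.
Proof.
  destruct z as [x y].
  pose proof (Cmod2_alt (x, y)) as hm; pose proof (Cmod_ge_0 (x, y)) as h0.
  pose proof (re_le_Cmod (x, y)) as hx.
  unfold Csqrt; cbn [Re Im fst snd] in *; set (m := Cmod (x, y)) in *.
  apply Rabs_le_between in hx.
  assert (h1 : 0 <= (m + x) / 2) by lra.
  assert (h2 : 0 <= (m - x) / 2) by lra.
  assert (h3 : sqrt ((m + x) / 2) * sqrt ((m - x) / 2) = Rabs y / 2).
  { rewrite <- sqrt_mult by easy.
    replace ((m + x) / 2 * ((m - x) / 2)) with (Rsqr (y / 2)) by (unfold Rsqr; nra).
    rewrite sqrt_Rsqr_abs; unfold Rdiv; rewrite Rabs_mult, (Rabs_pos_eq (/ 2)); lra. }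
  pose proof (sqrt_sqrt _ h1) as s1; pose proof (sqrt_sqrt _ h2) as s2.
  set (r := sqrt ((m + x) / 2)) in *; set (s := sqrt ((m - x) / 2)) in *.
  unfold Cmult; cbn [fst snd].
  destruct (Rlt_dec y 0) as [hy|hy].
  - rewrite Rabs_left in h3 by easy; apply injective_projections; cbn [fst snd]; nra.
  - rewrite Rabs_pos_eq in h3 by lra; apply injective_projections; cbn [fst snd]; nra.
Qed.

Lemma Csqrt_parts z :
  Re (Csqrt z) ^ 2 - Im (Csqrt z) ^ 2 = Re z /\ 2 * Re (Csqrt z) * Im (Csqrt z) = Im z.
Proof.
  pose proof (Csqrt_sqr z) as h; destruct (Csqrt z) as [a b]; subst z; simpl; split; ring.
Qed.

Lemma Csqrt_Re_pos z : 0 < Re z \/ Im z <> 0 -> 0 < Re (Csqrt z).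
Proof.
  intros h; destruct (Csqrt_Re_nonneg z) as [p|e]; [easy|].
  destruct (Csqrt_parts z) as [h1 h2]; rewrite <- e in h1, h2; nra.
Qed.

Lemma Csqrt_Im_sign z : Im z <> 0 -> 0 < Im z * Im (Csqrt z).
Proof.
  intros h; pose proof (Csqrt_Re_pos z (or_intror h)).
  destruct (Csqrt_parts z) as [_ h2]; rewrite <- h2 in *.
  assert (Im (Csqrt z) <> 0) by (intros e; apply h; rewrite e; ring).
  assert (0 < Im (Csqrt z) * Im (Csqrt z)) by nra; nra.
Qed.

Lemma Csqrt_RtoC x : 0 <= x -> Csqrt (RtoC x) = RtoC (sqrt x).
Proof.
  intros hx; unfold Csqrt; rewrite Cmod_R, Rabs_pos_eq by easy; simpl.
  replace ((x + x) / 2) with x by field; replace ((x - x) / 2) with 0 by field.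
  rewrite sqrt_0; apply injective_projections; simpl; [easy | ring].
Qed.

Lemma Csqrt_neg x : x < 0 -> Csqrt (RtoC x) = (0, sqrt (- x)).
Proof.
  intros hx; unfold Csqrt; rewrite Cmod_R, Rabs_left by easy; simpl.
  replace ((- x + x) / 2) with 0 by field; replace ((- x - x) / 2) with (- x) by field.
  rewrite sqrt_0; destruct (Rlt_dec 0 0); [lra|].
  apply injective_projections; simpl; [easy | ring].
Qed.

Lemma Cmod_Csqrt z : Cmod (Csqrt z) * Cmod (Csqrt z) = Cmod z.
Proof. now rewrite <- Cmod_mult, Csqrt_sqr. Qed.

(** The product of the difference and the sum of the two roots is y - z, and the sum has real part
    at least Re (Csqrt z) > 0. The point y is arbitrary, as [Csqrt] has a nonnegative real part
    everywhere. *)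
Lemma Csqrt_cont z : 0 < Re z \/ Im z <> 0 -> Ccont Csqrt z.
Proof.
  intros hz e he; pose proof (Csqrt_Re_pos z hz) as hr.
  exists (e * Re (Csqrt z)); split; [nra|]; intros y hy.
  pose proof (re_le_Cmod (Csqrt y + Csqrt z)) as h.
  pose proof (Csqrt_Re_nonneg y) as hn.
  apply Rabs_le_between in h; destruct h as [_ h].
  change (Re (Csqrt y + Csqrt z)) with (Re (Csqrt y) + Re (Csqrt z)) in h.
  assert (k : Cmod (Csqrt y - Csqrt z) * Cmod (Csqrt y + Csqrt z) = Cmod (y - z)).
  { rewrite <- Cmod_mult; f_equal.
    rewrite <- (Csqrt_sqr y) at 3; rewrite <- (Csqrt_sqr z) at 3; ring. }
  pose proof (Cmod_ge_0 (Csqrt y - Csqrt z)); nra.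
Qed.

Lemma Csqrt_cont_0 : Ccont Csqrt (RtoC 0).
Proof.
  intros e he; exists (e * e); split; [nra|]; intros y hy.
  rewrite Csqrt_RtoC, sqrt_0 by lra.
  replace (Csqrt y - RtoC 0)%C with (Csqrt y) by ring.
  replace (y - RtoC 0)%C with y in hy by ring.
  rewrite <- Cmod_Csqrt in hy; pose proof (Cmod_ge_0 (Csqrt y)); nra.
Qed.

(** Since S y - S z = (h y - h z) / (S y + S z), the difference quotient of S is that of h divided
    by S y + S z, which is continuous and nonzero at z. *)
Lemma Cholo_root h S z :
  Cholo h z -> Ccont S z -> near z (fun y => S y * S y = h y)%C -> S z <> RtoC 0 -> Cholo S z.
Proof.
  intros [p [hp k]] hS hq hz.
  assert (h2 : (S z + S z)%C <> RtoC 0).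
  { replace (S z + S z)%C with (RtoC 2 * S z)%C by ring; apply Cmult_neq_0; [|easy].
    intros e; apply RtoC_inj in e; lra. }
  assert (hc : Ccont (fun y => S y + S z)%C z) by (apply Ccont_plus; [easy | apply Ccont_const]).
  exists (fun y => p y * / (S y + S z))%C; split.
  - apply Ccont_mult; [easy|].
    apply (Ccont_comp Cinv (fun y => S y + S z)%C); [now apply Ccont_inv | easy].
  - pose proof (near_at _ _ hq) as hqz; simpl in hqz.
    assert (hn : near z (fun y => S y + S z <> RtoC 0)%C).
    { refine (near_imp _ _ _ _ (hc (Cmod (S z + S z)) _)); [|now apply Cmod_gt_0].
      intros y h1 e; rewrite e in h1.
      replace (RtoC 0 - (S z + S z))%C with (- (S z + S z))%C in h1 by ring.
      rewrite Cmod_opp in h1; lra. }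
    refine (near_imp _ _ _ _ (near_and _ _ _ k (near_and _ _ _ hq hn))).
    intros y [k1 [k2 k3]].
    rewrite <- k2, <- hqz in k1.
    replace (p y * / (S y + S z) * (y - z))%C with ((p y * (y - z)) / (S y + S z))%C
      by (field; easy).
    rewrite <- k1; field; easy.
Qed.

Lemma near_Re_pos z : 0 < Re z -> near z (fun y => 0 < Re y).
Proof.
  intros h; exists (Re z); split; [easy|]; intros y hy.
  pose proof (re_le_Cmod (y - z)) as k; apply Rabs_le_between in k.
  change (Re (y - z)) with (Re y - Re z) in k; lra.
Qed.

(** Dividing h by its value at z moves that value to 1, away from the cut of [Csqrt]; the factor S0
    then restores the prescribed value. This freedom of choice is what later selects a side of the
    real axis. *)
Lemma Cholo_local_sqrt h z S0 :
  near z (Cholo h) -> (S0 * S0)%C = h z -> S0 <> RtoC 0 ->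
  exists S, S z = S0 /\ near z (fun y => (S y * S y)%C = h y /\ Cholo S y).
Proof.
  intros hh h0 hS0.
  set (q := fun y => (/ (S0 * S0) * h y)%C).
  assert (hne : (S0 * S0)%C <> RtoC 0) by now apply Cmult_neq_0.
  assert (hq : near z (Cholo q)) by (revert hh; apply near_imp; intros; now apply Cholo_scal).
  assert (qz : q z = RtoC 1) by (unfold q; rewrite <- h0; field; easy).
  assert (hpos : near z (fun y => 0 < Re (q y))).
  { apply (Ccont_near q z (fun w => 0 < Re w)).
    - apply Cholo_cont, (near_at _ _ hq).
    - apply near_Re_pos; rewrite qz; simpl; lra. }
  assert (hsq : forall y, ((S0 * Csqrt (q y)) * (S0 * Csqrt (q y)))%C = h y).
  { intros y; replace ((S0 * Csqrt (q y)) * (S0 * Csqrt (q y)))%C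
      with ((S0 * S0) * (Csqrt (q y) * Csqrt (q y)))%C by ring.
    rewrite Csqrt_sqr; unfold q; field; easy. }
  exists (fun y => S0 * Csqrt (q y))%C; split.
  - rewrite qz, Csqrt_RtoC, sqrt_1 by lra; ring.
  - refine (near_imp _ _ _ _ (near_and _ _ _ hh (near_and _ _ _ hq hpos))).
    intros y [k1 [k2 k3]]; split; [apply hsq|].
    apply (Cholo_root h); auto.
    + apply Ccont_mult; [apply Ccont_const|].
      apply (Ccont_comp Csqrt q); [apply Csqrt_cont; now left | now apply Cholo_cont].
    + exists 1; split; [lra | auto].
    + apply Cmult_neq_0; [easy|]; intros e.
      pose proof (Csqrt_Re_pos (q y) (or_introl k3)) as p; rewrite e in p; simpl in p; lra.
Qed.

(** * The complex exponential, cosine and sine *)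

Lemma Cexp_plus a b : Cexp (a + b) = (Cexp a * Cexp b)%C.
Proof.
  destruct a as [a1 a2], b as [b1 b2]; unfold Cexp, Cmult; simpl.
  rewrite exp_plus, cos_plus, sin_plus; apply injective_projections; simpl; ring.
Qed.

Lemma Cexp_0 : Cexp (RtoC 0) = RtoC 1.
Proof.
  unfold Cexp; simpl; rewrite exp_0, cos_0, sin_0; apply injective_projections; simpl; ring.
Qed.

Lemma Cexp_neg a : (Cexp a * Cexp (- a))%C = RtoC 1.
Proof. rewrite <- Cexp_plus; replace (a + - a)%C with (RtoC 0) by ring; apply Cexp_0. Qed.

Lemma Cmod_le_sum z : Cmod z <= Rabs (Re z) + Rabs (Im z).
Proof.
  pose proof (Cmod2_alt z) as h; pose proof (Cmod_ge_0 z).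
  rewrite <- (pow2_abs (Re z)), <- (pow2_abs (Im z)) in h.
  pose proof (Rabs_pos (Re z)); pose proof (Rabs_pos (Im z)); nra.
Qed.

Lemma small_increment f l e :
  derivable_pt_lim f 0 l -> 0 < e ->
  exists d, 0 < d /\ forall h, Rabs h < d -> Rabs (f h - f 0 - l * h) <= e * Rabs h.
Proof.
  intros hf he; destruct (hf e he) as [[d hd] k]; exists d; split; [easy|]; intros h hh.
  destruct (Req_dec h 0) as [->|n].
  { rewrite Rabs_R0; replace (f 0 - f 0 - l * 0) with 0 by ring; rewrite Rabs_R0; lra. }
  specialize (k h n hh); rewrite Rplus_0_l in k.
  replace (f h - f 0 - l * h) with (((f h - f 0) / h - l) * h) by (field; easy).
  rewrite Rabs_mult; pose proof (Rabs_pos h); nra.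
Qed.

Lemma Cexp_increment e : 0 < e ->
  near (RtoC 0) (fun h => Cmod (Cexp h - RtoC 1 - h) <= e * Cmod h).
Proof.
  (* The real and imaginary parts of the remainder split into four terms bounded by 3km, km, 3km and
     2km with m = |h|, using |exp x| <= 3. Their sum 9km stays below e m when k <= e/12. *)
  intros he; set (k := Rmin 1 (e / 12)).
  assert (hk : 0 < k) by (apply Rmin_pos; lra).
  assert (hk1 : k <= 1) by apply Rmin_l.
  assert (hk2 : k <= e / 12) by apply Rmin_r.
  destruct (small_increment exp 1 k) as [d1 [p1 q1]]; auto.
  { rewrite <- exp_0; apply derivable_pt_lim_exp. }
  destruct (small_increment sin 1 k) as [d2 [p2 q2]]; auto.
  { rewrite <- cos_0; apply derivable_pt_lim_sin. }
  destruct (small_increment cos 0 k) as [d3 [p3 q3]]; auto.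
  { replace 0 with (- sin 0) at 2 by (rewrite sin_0; ring); apply derivable_pt_lim_cos. }
  set (d := Rmin (Rmin d1 d2) (Rmin d3 k)).
  assert (dd : d <= d1 /\ d <= d2 /\ d <= d3 /\ d <= k).
  { unfold d; pose proof (Rmin_l (Rmin d1 d2) (Rmin d3 k));
      pose proof (Rmin_r (Rmin d1 d2) (Rmin d3 k));
      pose proof (Rmin_l d1 d2); pose proof (Rmin_r d1 d2);
      pose proof (Rmin_l d3 k); pose proof (Rmin_r d3 k); lra. }
  exists d; split; [unfold d; repeat apply Rmin_pos; lra|]; intros h hy.
  replace (h - RtoC 0)%C with h in hy by ring; destruct h as [x y].
  pose proof (Rmax_Cmod (x, y)) as hm; simpl in hm.
  pose proof (Rmax_l (Rabs x) (Rabs y)); pose proof (Rmax_r (Rabs x) (Rabs y)).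
  set (m := Cmod (x, y)) in *.
  specialize (q1 x ltac:(lra)); specialize (q2 y ltac:(lra)); specialize (q3 y ltac:(lra)).
  rewrite exp_0 in q1; rewrite sin_0 in q2; rewrite cos_0 in q3.
  apply Rabs_le_between in q1, q2, q3.
  pose proof (Rabs_pos x); pose proof (Rabs_pos y).
  assert (hx : - m <= x <= m) by (apply Rabs_le_between; lra).
  assert (hy' : - m <= y <= m) by (apply Rabs_le_between; lra).
  assert (b1 : Rabs (exp x - 1 - x) <= k * m) by (apply Rabs_le; nra).
  assert (b2 : Rabs (sin y - y) <= k * m) by (apply Rabs_le; nra).
  assert (b3 : Rabs (cos y - 1) <= k * m) by (apply Rabs_le; nra).
  assert (b4 : Rabs (exp x - 1) <= 2 * m).
  { apply Rabs_le_between in b1; apply Rabs_le; nra. }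
  assert (b5 : Rabs (exp x) <= 3).
  { apply Rabs_le_between in b4; apply Rabs_le; lra. }
  eapply Rle_trans; [apply Cmod_le_sum|].
  replace (Re (Cexp (x, y) - RtoC 1 - (x, y)))
    with (exp x * (cos y - 1) + (exp x - 1 - x)) by (simpl; ring).
  replace (Im (Cexp (x, y) - RtoC 1 - (x, y)))
    with (exp x * (sin y - y) + (exp x - 1) * y) by (simpl; ring).
  pose proof (Rabs_triang (exp x * (cos y - 1)) (exp x - 1 - x)) as t1.
  pose proof (Rabs_triang (exp x * (sin y - y)) ((exp x - 1) * y)) as t2.
  rewrite Rabs_mult in t1; rewrite 2!Rabs_mult in t2.
  assert (0 <= m) by apply Cmod_ge_0.
  assert (Rabs (exp x) * Rabs (cos y - 1) <= 3 * (k * m))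
    by (apply Rmult_le_compat; auto using Rabs_pos).
  assert (Rabs (exp x) * Rabs (sin y - y) <= 3 * (k * m))
    by (apply Rmult_le_compat; auto using Rabs_pos).
  assert (Rabs (exp x - 1) * Rabs y <= 2 * m * k)
    by (apply Rmult_le_compat; auto using Rabs_pos; lra).
  assert (k * m <= e / 12 * m) by nra.
  assert (0 <= e * m) by nra.
  lra.
Qed.

Lemma Cholo_Cexp z : Cholo Cexp z.
Proof.
  exists (fun y => Cexp z * (if Ceq_dec y z then RtoC 1 else (Cexp (y - z) - RtoC 1) / (y - z)))%C.
  split.
  - apply Ccont_mult; [apply Ccont_const|].
    intros e he; destruct (Cexp_increment (e / 2)) as [d [hd k]]; [lra|].
    exists d; split; [easy|]; intros y hy.
    destruct (Ceq_dec z z) as [_|n]; [|easy].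
    destruct (Ceq_dec y z) as [_|n].
    { replace (RtoC 1 - RtoC 1)%C with (RtoC 0) by ring; now rewrite Cmod_0. }
    apply Cminus_eq_contra in n; pose proof (proj1 (Cmod_gt_0 _) n).
    replace ((Cexp (y - z) - RtoC 1) / (y - z) - RtoC 1)%C
      with ((Cexp (y - z) - RtoC 1 - (y - z)) / (y - z))%C by (field; easy).
    rewrite Cmod_div by easy; apply Rlt_div_l; [easy|].
    specialize (k (y - z)%C).
    replace (y - z - RtoC 0)%C with (y - z)%C in k by ring.
    specialize (k hy); nra.
  - exists 1; split; [lra|]; intros y _.
    destruct (Ceq_dec y z) as [->|n]; [ring|].
    apply Cminus_eq_contra in n.
    replace y with (z + (y - z))%C at 1 by ring; rewrite Cexp_plus; field; easy.
Qed.

Lemma C2_neq_0 : RtoC 2 <> RtoC 0.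
Proof. intros e; apply RtoC_inj in e; lra. Qed.

Ltac C_field := field; repeat split; try apply Ci_nz; intros e; apply RtoC_inj in e; lra.

Lemma Cmult_eq_0 a b : (a * b)%C = RtoC 0 -> a = RtoC 0 \/ b = RtoC 0.
Proof.
  intros h; destruct (Ceq_dec a (RtoC 0)) as [e|n]; [now left|right].
  destruct (Ceq_dec b (RtoC 0)) as [e|m]; [easy|].
  now destruct (Cmult_neq_0 a b).
Qed.

Lemma Csqr_eq a b : (a * a)%C = (b * b)%C -> a = b \/ a = (- b)%C.
Proof.
  intros h; destruct (Cmult_eq_0 (a - b) (a + b)) as [e|e].
  - replace ((a - b) * (a + b))%C with (a * a - b * b)%C by ring; rewrite h; ring.
  - left; now apply Ceq_minus.
  - right; apply Ceq_minus; rewrite <- e; ring.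
Qed.

Lemma Ccos_opp z : Ccos (- z) = Ccos z.
Proof.
  unfold Ccos; replace (Ci * - z)%C with (- (Ci * z))%C by ring.
  replace (- - (Ci * z))%C with (Ci * z)%C by ring; f_equal; ring.
Qed.

Lemma Csin_0 : Csin (RtoC 0) = RtoC 0.
Proof.
  unfold Csin; replace (- (Ci * RtoC 0))%C with (Ci * RtoC 0)%C by ring.
  unfold Cdiv; ring.
Qed.

Lemma Ci_sqr : (Ci * Ci)%C = (- RtoC 1)%C.
Proof. apply injective_projections; simpl; ring. Qed.

(** [field] does not know that [Ci * Ci] is -1. The relation is applied once here; the identities
    below use the sine only through its square, now free of [Ci] as a factor. *)
Lemma Csin_sqr z : (Csin z * Csin z)%C =
  (- ((Cexp (Ci * z) - Cexp (- (Ci * z))) * (Cexp (Ci * z) - Cexp (- (Ci * z)))) / RtoC 4)%C.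
Proof.
  unfold Csin, Cdiv.
  replace (/ (RtoC 2 * Ci))%C with (- (Ci / RtoC 2))%C.
  - set (w := (Cexp (Ci * z) - Cexp (- (Ci * z)))%C).
    replace (w * - (Ci / RtoC 2) * (w * - (Ci / RtoC 2)))%C
      with ((Ci * Ci) * (w * w) / RtoC 4)%C.
    + rewrite Ci_sqr; unfold Cdiv; ring.
    + C_field.
  - rewrite <- (Cmult_1_r (- (Ci / RtoC 2))), <- (Cinv_r (RtoC 2 * Ci)).
    + replace (- (Ci / RtoC 2) * (RtoC 2 * Ci * / (RtoC 2 * Ci)))%C
        with (- (Ci * Ci) * / (RtoC 2 * Ci))%C.
      * rewrite Ci_sqr; ring.
      * C_field.
    + apply Cmult_neq_0; [apply C2_neq_0 | apply Ci_nz].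
Qed.

Lemma Ccos_sqr_plus_Csin_sqr z : (Ccos z * Ccos z + Csin z * Csin z)%C = RtoC 1.
Proof.
  rewrite Csin_sqr; unfold Ccos; rewrite <- (Cexp_neg (Ci * z)) at 1.
  C_field.
Qed.

Lemma Ccos_double z : Ccos (RtoC 2 * z) = (Ccos z * Ccos z - Csin z * Csin z)%C.
Proof.
  rewrite Csin_sqr; unfold Ccos.
  replace (Ci * (RtoC 2 * z))%C with (Ci * z + Ci * z)%C by ring.
  replace (- (Ci * z + Ci * z))%C with (- (Ci * z) + - (Ci * z))%C by ring.
  rewrite !Cexp_plus.
  C_field.
Qed.

Lemma Ccos_parts x y : Ccos (x, y) = (cos x * cosh y, - (sin x * sinh y)).
Proof.
  unfold Ccos, Cexp, cosh, sinh, Cdiv.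
  rewrite <- RtoC_inv by lra.
  replace (Re (Ci * (x, y))) with (- y) by (simpl; ring).
  replace (Im (Ci * (x, y))) with x by (simpl; ring).
  replace (Re (- (Ci * (x, y)))) with y by (simpl; ring).
  replace (Im (- (Ci * (x, y)))) with (- x) by (simpl; ring).
  rewrite cos_neg, sin_neg; apply injective_projections; simpl; field.
Qed.

Lemma Cholo_Ccos z : Cholo Ccos z.
Proof.
  apply (Cholo_ext (fun y => / RtoC 2 * (Cexp (Ci * y) + Cexp (- Ci * y)))%C).
  - exists 1; split; [lra|]; intros y _; unfold Ccos, Cdiv.
    replace (- (Ci * y))%C with (- Ci * y)%C by ring; ring.
  - apply Cholo_scal, Cholo_plus; apply Cholo_comp;
      (apply Cholo_Cexp || apply Cholo_scal, Cholo_id).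
Qed.

Lemma Cholo_Csin z : Cholo Csin z.
Proof.
  apply (Cholo_ext (fun y => / (RtoC 2 * Ci) * (Cexp (Ci * y) + - Cexp (- Ci * y)))%C).
  - exists 1; split; [lra|]; intros y _; unfold Csin, Cdiv.
    replace (- (Ci * y))%C with (- Ci * y)%C by ring; ring.
  - apply Cholo_scal, Cholo_plus; [|apply Cholo_opp]; apply Cholo_comp;
      (apply Cholo_Cexp || apply Cholo_scal, Cholo_id).
Qed.

(** * The entire function cos (2 sqrt z) *)

Definition cos2sqrt (z : C) : C := Ccos (RtoC 2 * Csqrt z).

Lemma cos2sqrt_parts z :
  cos2sqrt z = (cos (2 * Re (Csqrt z)) * cosh (2 * Im (Csqrt z)),
                - (sin (2 * Re (Csqrt z)) * sinh (2 * Im (Csqrt z)))).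
Proof.
  unfold cos2sqrt; destruct (Csqrt z) as [x y].
  replace (RtoC 2 * (x, y))%C with ((2 * x, 2 * y) : C).
  - apply Ccos_parts.
  - apply injective_projections; simpl; ring.
Qed.

(* Away from 0 the cosine, being even, does not see the choice of the local
   branch of the square root; at 0 use cos 2w = 1 - 2 sin^2 w. *)
Lemma Cholo_cos2sqrt z : Cholo cos2sqrt z.
Proof.
  destruct (Ceq_dec z (RtoC 0)) as [->|n].
  - destruct (Cholo_Csin (RtoC 0)) as [p [hp k]].
    assert (s0 : Csqrt (RtoC 0) = RtoC 0) by (rewrite Csqrt_RtoC, sqrt_0; [easy | lra]).
    exists (fun y => - RtoC 2 * (p (Csqrt y) * p (Csqrt y)))%C.
    rewrite <- s0 in hp, k.
    assert (hc : Ccont (fun y => p (Csqrt y)) (RtoC 0))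
      by (apply Ccont_comp; [easy | apply Csqrt_cont_0]).
    split.
    + apply Ccont_mult; [apply Ccont_const | now apply Ccont_mult].
    + refine (near_imp _ _ _ _ (Ccont_near Csqrt _ _ Csqrt_cont_0 k)); intros y hy.
      rewrite s0, Csin_0 in hy.
      replace (Csin (Csqrt y) - RtoC 0)%C with (Csin (Csqrt y)) in hy by ring.
      replace (Csqrt y - RtoC 0)%C with (Csqrt y) in hy by ring.
      assert (hd : forall w, cos2sqrt w = (RtoC 1 - RtoC 2 * (Csin (Csqrt w) * Csin (Csqrt w)))%C).
      { intros w; unfold cos2sqrt; rewrite Ccos_double.
        rewrite <- (Ccos_sqr_plus_Csin_sqr (Csqrt w)); ring. }
      rewrite !hd, hy, s0, Csin_0.
      pose proof (Csqrt_sqr y) as q; set (w := Csqrt y) in *; rewrite <- q; ring.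
  - destruct (Cholo_local_sqrt (fun y => y) z (Csqrt z)) as [S [_ hS]].
    + exists 1; split; [lra|]; intros; apply Cholo_id.
    + apply Csqrt_sqr.
    + intros e; apply n; rewrite <- (Csqrt_sqr z), e; ring.
    + apply (Cholo_ext (fun y => Ccos (RtoC 2 * S y))).
      * revert hS; apply near_imp; intros y [h _]; unfold cos2sqrt.
        rewrite <- (Csqrt_sqr y) in h at 3; apply Csqr_eq in h; destruct h as [-> | ->]; [easy|].
        replace (RtoC 2 * - Csqrt y)%C with (- (RtoC 2 * Csqrt y))%C by ring; apply Ccos_opp.
      * apply (Cholo_comp Ccos (fun y => RtoC 2 * S y)%C); [apply Cholo_Ccos|].
        apply Cholo_scal; exact (proj2 (near_at _ _ hS)).
Qed.

(** * Eigenvalues, determinant and trace of T0 *)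

(** Applying the adjugate of M - mu to an eigenvector multiplies it by the characteristic value D,
    so D = 0. Conversely (b, mu - a) is an eigenvector unless it vanishes; then (mu - d, c) is one
    unless c = 0, and in that last case (1, 0) serves. *)
Lemma is_eigenvalue_charpoly M mu :
  is_eigenvalue M mu <-> (mu * mu - tr2 M * mu + det2 M)%C = RtoC 0.
Proof.
  destruct M as [[a b] [c d]]; unfold is_eigenvalue; cbn [tr2 det2]; split.
  - intros [[x y] [hv h]]; cbn [app2 fst snd] in h.
    pose proof (f_equal fst h) as h1; pose proof (f_equal snd h) as h2; cbn [fst snd] in h1, h2.
    set (D := (mu * mu - (a + d) * mu + (a * d - b * c))%C).
    assert (e1 : (a * x + b * y - mu * x)%C = RtoC 0) by (rewrite h1; ring).
    assert (e2 : (c * x + d * y - mu * y)%C = RtoC 0) by (rewrite h2; ring).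
    assert (k1 : (D * x)%C = RtoC 0).
    { transitivity ((d - mu) * (a * x + b * y - mu * x) - b * (c * x + d * y - mu * y))%C;
        [unfold D; ring | rewrite e1, e2; ring]. }
    assert (k2 : (D * y)%C = RtoC 0).
    { transitivity ((a - mu) * (c * x + d * y - mu * y) - c * (a * x + b * y - mu * x))%C;
        [unfold D; ring | rewrite e1, e2; ring]. }
    destruct (Cmult_eq_0 _ _ k1) as [e | ->]; [easy|].
    destruct (Cmult_eq_0 _ _ k2) as [e | ->]; [easy|].
    now destruct hv.
  - intros h.
    destruct (Ceq_dec b (RtoC 0)) as [hb|hb]; [destruct (Ceq_dec a mu) as [ha|ha]|].
    + destruct (Ceq_dec c (RtoC 0)) as [hc|hc].
      * exists (RtoC 1, RtoC 0); split.
        { intros e; injection e; lra. }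
        cbn [app2 fst snd]; rewrite hc, ha, hb; f_equal; ring.
      * exists ((mu - d)%C, c); split; [congruence|].
        cbn [app2 fst snd]; f_equal; [|ring]; apply Ceq_minus.
        transitivity (- (mu * mu - (a + d) * mu + (a * d - b * c)))%C; [ring|].
        rewrite h; ring.
    + exists (b, (mu - a)%C); split.
      { intros e; apply ha; symmetry; apply Ceq_minus; exact (f_equal snd e). }
      cbn [app2 fst snd]; f_equal; [ring|]; apply Ceq_minus.
      transitivity (- (mu * mu - (a + d) * mu + (a * d - b * c)))%C; [ring|].
      rewrite h; ring.
    + exists (b, (mu - a)%C); split; [congruence|].
      cbn [app2 fst snd]; f_equal; [ring|]; apply Ceq_minus.
      transitivity (- (mu * mu - (a + d) * mu + (a * d - b * c)))%C; [ring|].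
      rewrite h; ring.
Qed.

(** The functions s and c' enter the trace and the determinant only through this product. At l = 0
    the value chosen for s is harmless since c' vanishes there. *)
Lemma s_c'_fun l : (s_fun l * c'_fun l)%C = (- (Csin (Csqrt l) * Csin (Csqrt l)))%C.
Proof.
  unfold s_fun, c'_fun; destruct (Ceq_dec l (RtoC 0)) as [->|n].
  - rewrite Csqrt_RtoC, sqrt_0, Csin_0 by lra; ring.
  - field; intros e; apply n; rewrite <- (Csqrt_sqr l), e; ring.
Qed.

Lemma det_T0 dB dR l : det2 (T0 dB dR l) = RtoC (/ INR dR * / INR dB).
Proof.
  unfold T0, M0, Jmat, mul2, mk2, det2, s'_fun, c_fun; rewrite RtoC_mult.
  set (u := RtoC (/ INR dR)); set (v := RtoC (/ INR dB)).
  transitivity (u * v * (Ccos (Csqrt l) * Ccos (Csqrt l) - s_fun l * c'_fun l)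
                      * (Ccos (Csqrt l) * Ccos (Csqrt l) - s_fun l * c'_fun l))%C; [ring|].
  rewrite s_c'_fun.
  replace (Ccos (Csqrt l) * Ccos (Csqrt l) - - (Csin (Csqrt l) * Csin (Csqrt l)))%C
    with (Ccos (Csqrt l) * Ccos (Csqrt l) + Csin (Csqrt l) * Csin (Csqrt l))%C by ring.
  rewrite Ccos_sqr_plus_Csin_sqr; ring.
Qed.

(** Writing u, v for the reciprocals, the trace is (1 + uv) cos^2 w - (u + v) sin^2 w. The constants
    solve A + B = 1 + uv and B - A = u + v, which turns this into A (cos^2 w + sin^2 w) + B (cos^2 w
    - sin^2 w). *)
Lemma tr_T0 dB dR l : tr2 (T0 dB dR l) =
  (RtoC ((1 - / INR dR) * (1 - / INR dB) / 2)
   + RtoC ((1 + / INR dR) * (1 + / INR dB) / 2) * cos2sqrt l)%C.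
Proof.
  unfold T0, M0, Jmat, mul2, mk2, tr2, s'_fun, c_fun, cos2sqrt; rewrite Ccos_double.
  rewrite !RtoC_div, !RtoC_mult, !RtoC_minus, !RtoC_plus by lra.
  set (u := RtoC (/ INR dR)); set (v := RtoC (/ INR dB)).
  set (x := (Ccos (Csqrt l))) in *.
  transitivity ((RtoC 1 + u * v) * (x * x) + (u + v) * (s_fun l * c'_fun l))%C; [ring|].
  rewrite s_c'_fun; set (y := Csin (Csqrt l)).
  pose proof (Ccos_sqr_plus_Csin_sqr (Csqrt l)) as h; fold x y in h.
  replace (RtoC 1 + u * v)%C with ((RtoC 1 - u) * (RtoC 1 - v) / RtoC 2
    + (RtoC 1 + u) * (RtoC 1 + v) / RtoC 2)%C by C_field.
  replace (u + v)%C with (- ((RtoC 1 - u) * (RtoC 1 - v) / RtoC 2)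
    + (RtoC 1 + u) * (RtoC 1 + v) / RtoC 2)%C by C_field.
  set (A := ((RtoC 1 - u) * (RtoC 1 - v) / RtoC 2)%C).
  set (B := ((RtoC 1 + u) * (RtoC 1 + v) / RtoC 2)%C).
  transitivity (A * (x * x + y * y) + B * (x * x - y * y))%C; [ring|].
  rewrite h; ring.
Qed.

(** * The roots of w^2 - 2 t w + 1 *)

Definition in_cut (t : C) : Prop := Im t = 0 /\ -1 <= Re t <= 1.

(* The two roots [t + q], [t - q] of [w^2 - 2 t w + 1] have product 1. *)
Definition outer_root (t : C) : C :=
  let q := Csqrt (t * t - RtoC 1) in
  if Rlt_dec 1 (Cmod (t + q)) then (t + q)%C else (t - q)%C.

Lemma outer_root_eq t :
  ((outer_root t - t) * (outer_root t - t))%C = (t * t - RtoC 1)%C.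
Proof.
  unfold outer_root; pose proof (Csqrt_sqr (t * t - RtoC 1)) as h.
  set (q := Csqrt _) in *; rewrite <- h.
  destruct (Rlt_dec _ _); ring.
Qed.

Lemma conjugate_root_product w t :
  ((w - t) * (w - t))%C = (t * t - RtoC 1)%C -> (w * (RtoC 2 * t - w))%C = RtoC 1.
Proof.
  intros h; transitivity (t * t - (w - t) * (w - t))%C; [ring|]; rewrite h; ring.
Qed.

Lemma conjugate_root_Cmod w t :
  ((w - t) * (w - t))%C = (t * t - RtoC 1)%C -> Cmod w * Cmod (RtoC 2 * t - w) = 1.
Proof. intros h; now rewrite <- Cmod_mult, (conjugate_root_product w t h), Cmod_1. Qed.

(** On the unit circle the other root 1/w is the conjugate of w, so t, half the sum of the roots, is
    Re w. In coordinates [k1] and [k2] say w t = (Re w) w, and multiplying by the conjugate of w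
    gives t = Re w. *)
Lemma unit_root_in_cut w t :
  ((w - t) * (w - t))%C = (t * t - RtoC 1)%C -> Cmod w = 1 -> in_cut t.
Proof.
  intros h hw; apply conjugate_root_product in h.
  pose proof (Cmod2_alt w) as m; rewrite hw in m.
  destruct w as [a b], t as [u v].
  pose proof (f_equal fst h) as h1; pose proof (f_equal snd h) as h2; simpl in h1, h2, m.
  assert (e1 : a * (2 * u - a) - b * (2 * v - b) = 1) by lra.
  assert (e2 : a * (2 * v - b) + b * (2 * u - a) = 0) by lra.
  assert (m' : a * a + b * b = 1) by lra.
  assert (k1 : a * u - b * v = a * a) by lra.
  assert (k2 : a * v + b * u = a * b) by lra.
  assert (hv : v = a * (a * v + b * u) - b * (a * u - b * v))
    by (transitivity ((a * a + b * b) * v); [rewrite m'|]; ring).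
  assert (hu : u = a * (a * u - b * v) + b * (a * v + b * u))
    by (transitivity ((a * a + b * b) * u); [rewrite m'|]; ring).
  rewrite k1, k2 in hv, hu.
  assert (u = a) by (rewrite hu; transitivity (a * (a * a + b * b)); [|rewrite m']; ring).
  assert (v = 0) by (rewrite hv; ring).
  split; simpl; [easy | nra].
Qed.

(** Here (w - t)^2 = t^2 - 1 is real and at most 0, so w - t is imaginary and |w|^2 = t^2 + (1 -
    t^2). *)
Lemma in_cut_unit_root w t :
  ((w - t) * (w - t))%C = (t * t - RtoC 1)%C -> in_cut t -> Cmod w = 1.
Proof.
  intros h [hi hr]; pose proof (Cmod2_alt w) as m; pose proof (Cmod_ge_0 w).
  destruct w as [a b], t as [u v].
  pose proof (f_equal fst h) as h1; pose proof (f_equal snd h) as h2; simpl in h1, h2, m, hi, hr.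
  subst v.
  assert (e2 : (a - u) * b = 0) by lra.
  assert (e1 : (a - u) * (a - u) - b * b = u * u - 1) by lra.
  assert (a - u = 0).
  { apply Rmult_integral in e2; destruct e2 as [e2 | ->]; [easy | nra]. }
  assert (hm : Cmod (a, b) * Cmod (a, b) = 1) by nra.
  nra.
Qed.

(** If the test in [outer_root] fails, then |t + q| <= 1, so the product 1 forces |t - q| >= 1;
    equality would put t in the cut. *)
Lemma outer_root_gt t : ~ in_cut t -> 1 < Cmod (outer_root t).
Proof.
  intros h; pose proof (outer_root_eq t) as e; pose proof (conjugate_root_Cmod _ _ e) as m.
  destruct (Req_dec (Cmod (outer_root t)) 1) as [e1|n].
  { now destruct h; apply (unit_root_in_cut (outer_root t)). }
  unfold outer_root in *; set (q := Csqrt _) in *.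
  destruct (Rlt_dec 1 (Cmod (t + q))) as [k|k]; [easy|].
  replace (RtoC 2 * t - (t - q))%C with (t + q)%C in m by ring.
  pose proof (Cmod_ge_0 (t - q)); nra.
Qed.

Lemma outer_root_unique w t :
  ((w - t) * (w - t))%C = (t * t - RtoC 1)%C -> 1 < Cmod w ->
  ~ in_cut t /\ w = outer_root t.
Proof.
  intros h hw.
  assert (hc : ~ in_cut t) by (intros k; pose proof (in_cut_unit_root w t h k); lra).
  split; [easy|].
  pose proof (outer_root_eq t) as e; pose proof (outer_root_gt t hc) as g.
  pose proof (conjugate_root_Cmod _ _ e) as m.
  rewrite <- h in e; apply Csqr_eq in e; destruct e as [e|e].
  - replace w with (t + (w - t))%C by ring; rewrite <- e; ring.
  - replace (RtoC 2 * t - outer_root t)%C with w in m; [nra|].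
    transitivity (t - - (w - t))%C; [ring | rewrite <- e; ring].
Qed.

(** Because |t + q|^2 - |t - q|^2 = 4 (u r + v s) and the two moduli have product 1, it is enough
    that u r + v s > 0. The imaginary part of q^2 = t^2 - 1 gives r s = u v, whence s^2 (u r + v s)
    = s v (u^2 + s^2), which is positive when s v is. *)
Lemma Cmod_root_gt t q :
  (q * q)%C = (t * t - RtoC 1)%C -> 0 < Im q * Im t -> 1 < Cmod (t + q).
Proof.
  intros h hp.
  assert (h' : ((t + q - t) * (t + q - t))%C = (t * t - RtoC 1)%C) by (rewrite <- h; ring).
  pose proof (conjugate_root_Cmod _ _ h') as m.
  replace (RtoC 2 * t - (t + q))%C with (t - q)%C in m by ring.
  pose proof (Cmod2_alt (t + q)) as m1; pose proof (Cmod2_alt (t - q)) as m2.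
  pose proof (Cmod_ge_0 (t + q)); pose proof (Cmod_ge_0 (t - q)).
  destruct t as [u v], q as [r s].
  pose proof (f_equal fst h) as h1; pose proof (f_equal snd h) as h2.
  simpl in h1, h2, hp, m1, m2.
  set (a := Cmod _) in *; set (b := Cmod ((u, v) - (r, s))) in *.
  assert (e : r * s = u * v) by lra.
  assert (hD : s * s * (u * r + v * s) = (s * v) * (u * u + s * s)).
  { transitivity (u * s * (r * s) + v * s * (s * s)); [ring | rewrite e; ring]. }
  assert (s <> 0) by (intros ->; lra).
  assert (0 < s * s) by nra.
  assert (0 < u * u + s * s) by nra.
  assert (0 < s * s * (u * r + v * s)) by (rewrite hD; now apply Rmult_lt_0_compat).
  assert (0 < u * r + v * s) by nra.
  assert (b * b < a * a) by nra.
  nra.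
Qed.

Lemma in_cut_open_sqr t : in_cut t -> (t * t)%C <> RtoC 1 -> -1 < Re t < 1.
Proof.
  destruct t as [u v]; intros [h1 h2] n; simpl in *; subst v.
  assert (u <> 1) by (intros ->; apply n; apply injective_projections; simpl; ring).
  assert (u <> -1) by (intros ->; apply n; apply injective_projections; simpl; ring).
  lra.
Qed.

Lemma not_in_cut_sqr t : ~ in_cut t -> (t * t - RtoC 1)%C <> RtoC 0.
Proof.
  intros h e; apply h.
  replace (t * t - RtoC 1)%C with (t * t - RtoC 1 * RtoC 1)%C in e by ring.
  apply Ceq_minus, Csqr_eq in e; destruct e as [-> | ->]; split; simpl; lra.
Qed.

Lemma Cholo_sqr_minus_1 f z : Cholo f z -> Cholo (fun y => f y * f y - RtoC 1)%C z.
Proof.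
  intros h; apply (Cholo_plus (fun y => f y * f y)%C (fun _ => - RtoC 1)%C).
  - now apply Cholo_mult.
  - apply Cholo_const.
Qed.

Lemma near_true z (P : C -> Prop) : (forall y, P y) -> near z P.
Proof. intros h; exists 1; split; [lra | auto]. Qed.

Lemma near_Cmod_gt z c : c < Cmod z -> near z (fun y => c < Cmod y).
Proof.
  intros h; exists (Cmod z - c); split; [lra|]; intros y hy.
  pose proof (Cmod_triangle (- (y - z)) y) as t; rewrite Cmod_opp in t.
  replace (- (y - z) + y)%C with z in t by ring; lra.
Qed.

Lemma Cholo_outer_root f z : (forall y, Cholo f y) -> ~ in_cut (f z) ->
  near z (fun y => Cholo (fun y => outer_root (f y)) y /\ ~ in_cut (f y)).
Proof.
  intros hf hc; pose proof (outer_root_eq (f z)) as e.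
  destruct (Cholo_local_sqrt (fun y => f y * f y - RtoC 1)%C z (outer_root (f z) - f z)%C)
    as [S [hS0 hS]].
  - apply near_true; intros; now apply Cholo_sqr_minus_1.
  - exact e.
  - intros k; rewrite k in e; apply (not_in_cut_sqr _ hc); rewrite <- e; ring.
  - assert (hg : near z (Cholo (fun y => f y + S y)%C))
      by (revert hS; apply near_imp; intros y [_ h]; now apply Cholo_plus).
    assert (hm : near z (fun y => 1 < Cmod (f y + S y))).
    { apply (Ccont_near (fun y => f y + S y)%C z (fun w => 1 < Cmod w)).
      - apply Cholo_cont, (near_at _ _ hg).
      - apply near_Cmod_gt; rewrite hS0.
        replace (f z + (outer_root (f z) - f z))%C with (outer_root (f z)) by ring.
        now apply outer_root_gt. }
    assert (he : near z (fun y => ~ in_cut (f y) /\ (f y + S y)%C = outer_root (f y))).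
    { refine (near_imp _ _ _ _ (near_and _ _ _ hS hm)); intros y [[h1 _] h2].
      apply outer_root_unique; [|easy]; rewrite <- h1; ring. }
    refine (near_imp _ _ _ _ (near_and _ _ _ hg (near_near _ _ he))); intros y [h1 h2].
    split; [|exact (proj1 (near_at _ _ h2))].
    apply (Cholo_ext (fun y => f y + S y)%C); [|easy].
    revert h2; apply near_imp; now intros w [_ h].
Qed.

(** * The normalised half trace [tau] and its preimage of the cut *)

Lemma cosh_sqr x : cosh x * cosh x = 1 + sinh x * sinh x.
Proof.
  unfold cosh, sinh; assert (h : exp x * exp (- x) = 1).
  { rewrite <- exp_plus, Rplus_opp_r; apply exp_0. }
  nra.
Qed.

Lemma sinh_sign x : x <> 0 -> 0 < x * sinh x.
Proof.
  intros h; unfold sinh; destruct (Rdichotomy _ _ h) as [k|k].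
  - assert (exp x < exp (- x)) by (apply exp_increasing; lra); nra.
  - assert (exp (- x) < exp x) by (apply exp_increasing; lra); nra.
Qed.

Lemma sin_zero_cos x : sin x = 0 -> cos x = 1 \/ cos x = -1.
Proof.
  intros h; pose proof (sin2_cos2 x) as e; rewrite h in e; unfold Rsqr in e.
  assert (k : (cos x - 1) * (cos x + 1) = 0) by lra.
  apply Rmult_integral in k; lra.
Qed.

Definition tau (A B : R) (z : C) : C := (RtoC A + RtoC B * cos2sqrt z)%C.

Lemma Cholo_tau A B z : Cholo (tau A B) z.
Proof. apply Cholo_plus; [apply Cholo_const | apply Cholo_scal, Cholo_cos2sqrt]. Qed.

Lemma tau_parts A B z :
  Re (tau A B z) = A + B * (cos (2 * Re (Csqrt z)) * cosh (2 * Im (Csqrt z))) /\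
  Im (tau A B z) = - (B * (sin (2 * Re (Csqrt z)) * sinh (2 * Im (Csqrt z)))).
Proof. unfold tau; rewrite cos2sqrt_parts; split; simpl; ring. Qed.

Lemma tau_nonneg A B x : 0 <= x -> tau A B (RtoC x) = RtoC (A + B * cos (2 * sqrt x)).
Proof.
  intros hx; unfold tau; rewrite cos2sqrt_parts, Csqrt_RtoC by easy.
  rewrite re_RtoC, im_RtoC, Rmult_0_r, cosh_0, sinh_0.
  apply injective_projections; simpl; ring.
Qed.

Lemma tau_neg A B x : x < 0 -> tau A B (RtoC x) = RtoC (A + B * cosh (2 * sqrt (- x))).
Proof.
  intros hx; unfold tau; rewrite cos2sqrt_parts, Csqrt_neg by easy; simpl.
  rewrite Rmult_0_r, cos_0, sin_0.
  apply injective_projections; simpl; ring.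
Qed.

Lemma tau_real A B x : tau A B (RtoC x) = RtoC (Re (tau A B (RtoC x))).
Proof.
  destruct (Rlt_le_dec x 0); [rewrite tau_neg by easy | rewrite tau_nonneg by easy];
    now rewrite re_RtoC.
Qed.

(** Let sqrt z = a + i b. If b is nonzero, Im tau = 0 forces sin (2a) = 0, so cos (2a) is 1 or -1;
    as cosh (2b) > 1, the value of tau is above A + B >= 1 or below A - B <= -1. Hence b = 0 and z =
    a^2. *)
Lemma tau_in_cut A B z : 1 <= A + B -> 1 <= B - A ->
  in_cut (tau A B z) -> Im z = 0 /\ 0 <= Re z.
Proof.
  intros h1 h2 [hi hr]; destruct (tau_parts A B z) as [e1 e2].
  rewrite e1 in hr; rewrite e2 in hi; clear e1 e2.
  destruct (Csqrt_parts z) as [k1 k2].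
  set (a := Re (Csqrt z)) in *; set (b := Im (Csqrt z)) in *.
  assert (hb : b = 0).
  { destruct (Req_dec b 0) as [e|n]; [easy|exfalso].
    pose proof (sinh_sign (2 * b) ltac:(lra)) as hs.
    assert (sinh (2 * b) <> 0) by (intros e; rewrite e in hs; lra).
    assert (hB : B * sinh (2 * b) <> 0) by (apply Rmult_integral_contrapositive; split; lra).
    assert (sin (2 * a) = 0).
    { assert (e : (B * sinh (2 * b)) * sin (2 * a) = 0) by lra.
      now apply Rmult_integral in e; destruct e. }
    pose proof (cosh_sqr (2 * b)) as hc.
    assert (0 < sinh (2 * b) * sinh (2 * b)) by nra.
    assert (0 < cosh (2 * b)).
    { unfold cosh; pose proof (exp_pos (2 * b)); pose proof (exp_pos (- (2 * b))); lra. }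
    assert (1 < cosh (2 * b)) by nra.
    destruct (sin_zero_cos (2 * a)) as [e|e]; [easy| |]; rewrite e in hr; nra. }
  rewrite hb in k1, k2; split; [lra|]; rewrite <- k1; nra.
Qed.

(** * Boundary values on the real axis from either side *)

Definition half_sign (up : bool) : R := if up then 1 else -1.

(** The sign of -sin (2 sqrt x). Where the sine vanishes the value -1 is a default: under the bounds
    on A and B, such a point either has |T| = 1, where the square root in [boundary_root] is 0, or
    lies off the cut. *)
Definition sign_neg_sin (x : R) : R := if Rlt_dec (sin (2 * sqrt x)) 0 then 1 else -1.

(** On the cut the roots are T + i sqrt (1 - T^2) and its conjugate. By [Cmod_root_gt] the one
    approached from a side is the one whose imaginary part has the sign of Im tau on that side. *)
Definition boundary_root (A B : R) (up : bool) (x : R) : C :=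
  let T := Re (tau A B (RtoC x)) in
  if Rle_dec (Rabs T) 1
  then (T, half_sign up * sign_neg_sin x * sqrt (1 - T * T))
  else outer_root (tau A B (RtoC x)).

Definition extended_root (A B : R) (up : bool) : C -> C :=
  half_ext up (fun z => outer_root (tau A B z)) (boundary_root A B up).

Lemma half_ext_cases up f b z : closed_half up z ->
  (0 < half_sign up * Im z /\ half_ext up f b z = f z) \/
  (z = RtoC (Re z) /\ half_ext up f b z = b (Re z)).
Proof.
  unfold closed_half, half_ext, half_sign; destruct up; intros h.
  - destruct (Rlt_dec 0 (Im z)); [left | right]; split; try easy; [lra|].
    apply injective_projections; simpl; [easy | unfold Im in *; lra].
  - destruct (Rlt_dec (Im z) 0); [left | right]; split; try easy; [lra|].
    apply injective_projections; simpl; [easy | unfold Im in *; lra].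
Qed.

Lemma boundary_root_eq A B up x :
  let t := tau A B (RtoC x) in
  ((boundary_root A B up x - t) * (boundary_root A B up x - t))%C = (t * t - RtoC 1)%C.
Proof.
  intros t; unfold boundary_root; fold t.
  destruct (Rle_dec (Rabs (Re t)) 1) as [h|h]; [|apply outer_root_eq].
  assert (e : t = RtoC (Re t)) by apply tau_real.
  set (T := Re t) in *; rewrite e; apply Rabs_le_between in h.
  pose proof (sqrt_sqrt (1 - T * T) ltac:(nra)) as k.
  set (s := half_sign up * sign_neg_sin x).
  assert (hs : s * s = 1).
  { unfold s, half_sign, sign_neg_sin; destruct up, (Rlt_dec _ _); ring. }
  apply injective_projections; simpl; [|ring].
  transitivity (- (s * s * (sqrt (1 - T * T) * sqrt (1 - T * T)))); [ring|].
  rewrite hs, k; ring.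
Qed.

Lemma extended_root_eq A B up y : closed_half up y ->
  ((extended_root A B up y - tau A B y) * (extended_root A B up y - tau A B y))%C
  = (tau A B y * tau A B y - RtoC 1)%C.
Proof.
  intros h; unfold extended_root.
  destruct (half_ext_cases up (fun z => outer_root (tau A B z)) (boundary_root A B up) y h)
    as [[_ ->] | [e ->]].
  - apply outer_root_eq.
  - rewrite e at 2 4 5 6; apply boundary_root_eq.
Qed.

Lemma near_Im_sign c z : 0 < c * Im z -> near z (fun y => 0 < c * Im y).
Proof.
  intros h; exists (Rabs (Im z)); split.
  - apply Rabs_pos_lt; intros e; rewrite e in h; lra.
  - intros y hy; pose proof (Rmax_Cmod (y - z)%C) as k.
    pose proof (Rmax_r (Rabs (fst (y - z)%C)) (Rabs (snd (y - z)%C))) as k'.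
    assert (d : Rabs (Im y - Im z) < Rabs (Im z)).
    { change (Rabs (snd (y - z)%C) < Rabs (Im z)); lra. }
    apply Rabs_def2 in d; unfold Rabs in d; destruct (Rcase_abs (Im z)); nra.
Qed.

Lemma near_Csqrt_sin x : 0 < x -> sin (2 * sqrt x) <> 0 ->
  near (RtoC x) (fun y => 0 < sin (2 * sqrt x) * sin (2 * Re (Csqrt y))).
Proof.
  intros hx hs; set (s := sin (2 * sqrt x)) in *.
  destruct (continuity_sin (2 * sqrt x) (Rabs s)) as [d [hd k]]; [now apply Rabs_pos_lt|].
  assert (hc : Ccont Csqrt (RtoC x)) by (apply Csqrt_cont; left; now simpl).
  refine (near_imp _ _ _ _ (hc (d / 2) _)); [|lra]; intros y hy.
  pose proof (re_le_Cmod (Csqrt y - Csqrt (RtoC x))) as h.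
  rewrite (Csqrt_RtoC x) in h, hy by lra.
  change (Re (Csqrt y - RtoC (sqrt x))) with (Re (Csqrt y) - sqrt x) in h.
  destruct (Req_dec (2 * sqrt x) (2 * Re (Csqrt y))) as [e|n].
  { rewrite <- e; fold s; nra. }
  specialize (k (2 * Re (Csqrt y))).
  assert (k' : Rabs (sin (2 * Re (Csqrt y)) - s) < Rabs s).
  { apply k; split; [split; [easy | exact n]|].
    change (Rabs (2 * Re (Csqrt y) - 2 * sqrt x) < d).
    replace (2 * Re (Csqrt y) - 2 * sqrt x) with (2 * (Re (Csqrt y) - sqrt x)) by ring.
    rewrite Rabs_mult, Rabs_pos_eq by lra; lra. }
  apply Rabs_def2 in k'; unfold Rabs in k'; destruct (Rcase_abs s); nra.
Qed.

(* On the real axis the sign of the square root is dictated by the side from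
   which it is approached: [Im tau] has the sign of [- sin (2 Re w) * Im w]. *)
Lemma extended_root_local A B up z :
  1 <= A + B -> 1 <= B - A -> closed_half up z -> (tau A B z * tau A B z)%C <> RtoC 1 ->
  exists g, near z (Cholo g) /\
    near z (fun y => closed_half up y -> g y = extended_root A B up y).
Proof.
  intros h1 h2 hz hD.
  set (t := tau A B) in *.
  assert (dec : in_cut (t z) \/ ~ in_cut (t z)).
  { unfold in_cut; destruct (Req_dec (Im (t z)) 0), (Rle_dec (-1) (Re (t z))),
      (Rle_dec (Re (t z)) 1); tauto. }
  destruct dec as [hc|hc].
  - destruct (tau_in_cut A B z h1 h2 hc) as [zi zr].
    pose proof (in_cut_open_sqr _ hc hD) as hT.
    set (x := Re z) in *.
    assert (ez : z = RtoC x) by (apply injective_projections; [easy | exact zi]).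
    assert (tz : t z = RtoC (A + B * cos (2 * sqrt x))) by (rewrite ez; now apply tau_nonneg).
    set (T := A + B * cos (2 * sqrt x)) in *.
    rewrite tz, re_RtoC in hT.
    assert (hsin : sin (2 * sqrt x) <> 0).
    (* A zero of the sine would give T = A + B >= 1 or T = A - B <= -1, outside the open
       interval. *)
    { intros e; destruct (sin_zero_cos _ e) as [k|k]; unfold T in hT; rewrite k in hT; lra. }
    assert (hx : 0 < x).
    { destruct zr as [p|e]; [easy|]; rewrite <- e, sqrt_0, Rmult_0_r, sin_0 in hsin; lra. }
    set (s := half_sign up * sign_neg_sin x).
    assert (hs : s * s = 1).
    { unfold s, half_sign, sign_neg_sin; destruct up, (Rlt_dec _ _); ring. }
    assert (hq : 0 < sqrt (1 - T * T)) by (apply sqrt_lt_R0; nra).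
    pose proof (sqrt_sqrt (1 - T * T) ltac:(nra)) as hq2.
    set (q := sqrt (1 - T * T)) in *.
    assert (hs0 : s * q <> 0) by (intros e; apply Rmult_integral in e; destruct e; nra).
    (* The branch is started at the imaginary part that [boundary_root] takes at x. *)
    destruct (Cholo_local_sqrt (fun y => t y * t y - RtoC 1)%C z (0, s * q)) as [S [hS0 hS]].
    + apply near_true; intros; apply Cholo_sqr_minus_1, Cholo_tau.
    + rewrite tz; apply injective_projections; simpl; [|ring].
      transitivity (- (s * s * (q * q))); [ring | rewrite hs, hq2; ring].
    + intros e; apply hs0; exact (f_equal snd e).
    + exists (fun y => t y + S y)%C; split.
      { revert hS; apply near_imp; intros y [_ h]; apply Cholo_plus; [apply Cholo_tau | easy]. }
      assert (n2 : near z (fun y => 0 < s * Im (S y))).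
      { apply (Ccont_near S z (fun w => 0 < s * Im w)).
        - apply Cholo_cont; exact (proj2 (near_at _ _ hS)).
        - apply near_Im_sign; rewrite hS0; simpl; nra. }
      assert (n3 : near z (fun y => 0 < sin (2 * sqrt x) * sin (2 * Re (Csqrt y))))
        by (rewrite ez; now apply near_Csqrt_sin).
      assert (n4 : near z (fun y => 0 < Re y)) by now apply near_Re_pos.
      refine (near_imp _ _ _ _
        (near_and _ _ _ hS (near_and _ _ _ n2 (near_and _ _ _ n3 n4)))).
      intros y [[e1 _] [e2 [e3 e4]]] hy.
      unfold extended_root.
      destruct (half_ext_cases up (fun z => outer_root (tau A B z)) (boundary_root A B up) y hy)
        as [[e5 ->] | [e5 ->]].
      * apply outer_root_unique; [fold t; rewrite <- e1; ring|].
        (* Both Im (S y) and Im (t y) have the sign s: the first by continuity, the second because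
           [Csqrt] preserves the sign of the imaginary part and the sine keeps its sign near x. *)
        apply Cmod_root_gt; [exact e1|].
        destruct (tau_parts A B y) as [_ e6]; fold t in e6; rewrite e6.
        assert (hy0 : Im y <> 0) by (intros e; rewrite e in e5; lra).
        pose proof (Csqrt_Im_sign y hy0) as e7.
        set (b := Im (Csqrt y)) in *; set (sy := sin (2 * Re (Csqrt y))) in *.
        assert (e8 : 0 < half_sign up * b).
        { unfold half_sign in *; destruct up; nra. }
        assert (e9 : 0 < half_sign up * sinh (2 * b)).
        { assert (b <> 0) by (intros e; rewrite e in e8; lra).
          pose proof (sinh_sign (2 * b) ltac:(lra)).
          unfold half_sign in *; destruct up; nra. }
        assert (e10 : 0 < - (sign_neg_sin x * sy)).
        { unfold sign_neg_sin; destruct (Rlt_dec _ _); nra. }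
        assert (e11 : 0 < s * (- (B * (sy * sinh (2 * b))))).
        { replace (s * (- (B * (sy * sinh (2 * b)))))
            with (B * (- (sign_neg_sin x * sy) * (half_sign up * sinh (2 * b))))
            by (unfold s; ring).
          apply Rmult_lt_0_compat; [lra | now apply Rmult_lt_0_compat]. }
        replace (Im (S y) * (- (B * (sy * sinh (2 * b)))))
          with ((s * s) * (Im (S y) * (- (B * (sy * sinh (2 * b)))))) by (rewrite hs; ring).
        replace ((s * s) * (Im (S y) * (- (B * (sy * sinh (2 * b))))))
          with ((s * Im (S y)) * (s * (- (B * (sy * sinh (2 * b)))))) by ring.
        now apply Rmult_lt_0_compat.
      (* On the axis t y is real and Im (S y) is nonzero, so the square of S y being real makes S y
         imaginary, with square T'^2 - 1; its sign s is still the one chosen by [boundary_root] at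
         x'. *)
      * set (x' := Re y) in *.
        assert (ety : t y = RtoC (Re (t y))) by (rewrite e5; apply tau_real).
        unfold boundary_root; rewrite <- e5; fold t.
        set (T' := Re (t y)) in *.
        rewrite ety in e1 |- *.
        destruct (S y) as [r i]; simpl in e2.
        pose proof (f_equal fst e1) as f1; pose proof (f_equal snd e1) as f2; simpl in f1, f2.
        assert (hi : i <> 0) by (intros ->; lra).
        assert (hr : r = 0).
        { assert (e : r * i = 0) by lra; apply Rmult_integral in e; destruct e; [easy | lra]. }
        subst r.
        assert (hi2 : i * i = 1 - T' * T') by lra.
        assert (0 < i * i) by nra.
        destruct (Rle_dec (Rabs T') 1) as [k|k]; [|destruct k; apply Rabs_le; nra].
        assert (es : half_sign up * sign_neg_sin x' = s).
        { unfold s; f_equal; rewrite e5, Csqrt_RtoC, re_RtoC in e3 by lra.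
          unfold sign_neg_sin; destruct (Rlt_dec _ _), (Rlt_dec _ _); nra. }
        rewrite es.
        assert (ei : sqrt (1 - T' * T') = s * i).
        { rewrite <- hi2; replace (i * i) with ((s * i) * (s * i)).
          - apply sqrt_square; lra.
          - transitivity ((s * s) * (i * i)); [ring | rewrite hs; ring]. }
        rewrite ei; apply injective_projections; simpl; [ring|].
        transitivity ((s * s) * i); [rewrite hs; ring | ring].
  - exists (fun y => outer_root (t y)).
    pose proof (Cholo_outer_root t z (Cholo_tau A B) hc) as k; split.
    + revert k; apply near_imp; now intros y [h _].
    + revert k; apply near_imp; intros y [_ h] hy; unfold extended_root.
      destruct (half_ext_cases up (fun z => outer_root (tau A B z)) (boundary_root A B up) y hy)
        as [[_ ->] | [e ->]]; [easy|].
      unfold boundary_root; rewrite <- e; fold t.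
      destruct (Rle_dec _ _) as [l|l]; [|easy].
      destruct h; apply Rabs_le_between in l; split; [|easy].
      unfold t; rewrite e, tau_real; apply im_RtoC.
Qed.

Lemma extended_root_cont A B up z : 1 <= A + B -> 1 <= B - A -> closed_half up z ->
  forall e, 0 < e -> near z (fun y => closed_half up y ->
    Cmod (extended_root A B up y - extended_root A B up z) < e).
Proof.
  intros h1 h2 hz e he.
  destruct (Ceq_dec (tau A B z * tau A B z) (RtoC 1)) as [hD|hD].
  - pose proof (Cholo_cont _ _ (Cholo_tau A B z)) as hc.
    pose proof (Cholo_cont _ _ (Cholo_sqr_minus_1 _ _ (Cholo_tau A B z))) as hq.
    (* At z the root equals tau. Asking |tau^2 - 1| < d^2 makes the root at y closer than d to tau
       y, and the variation of tau uses the other half of e. *)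
    set (d := e / 2); assert (hd : 0 < d) by (unfold d; lra).
    assert (hdd : 0 < d * d) by nra.
    refine (near_imp _ _ _ _ (near_and _ _ _ (hc d hd) (hq (d * d) hdd))).
    cbn beta; intros y [k1 k2] hy.
    assert (ez : (extended_root A B up z - tau A B z)%C = RtoC 0).
    { pose proof (extended_root_eq A B up z hz) as k; rewrite hD in k.
      replace (RtoC 1 - RtoC 1)%C with (RtoC 0) in k by ring.
      now destruct (Cmult_eq_0 _ _ k). }
    pose proof (extended_root_eq A B up y hy) as ey.
    rewrite hD, <- ey in k2.
    set (w := (extended_root A B up y - tau A B y)%C) in *.
    replace (w * w - (RtoC 1 - RtoC 1))%C with (w * w)%C in k2 by ring.
    rewrite Cmod_mult in k2.
    assert (Cmod w < d) by (pose proof (Cmod_ge_0 w); nra).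
    replace (extended_root A B up y - extended_root A B up z)%C
      with (w + (tau A B y - tau A B z) - (extended_root A B up z - tau A B z))%C
      by (unfold w; ring).
    rewrite ez.
    replace (w + (tau A B y - tau A B z) - RtoC 0)%C with (w + (tau A B y - tau A B z))%C by ring.
    pose proof (Cmod_triangle w (tau A B y - tau A B z)); unfold d in *; lra.
  - destruct (extended_root_local A B up z h1 h2 hz hD) as [g [hg hk]].
    pose proof (near_at _ _ hk hz) as gz; simpl in gz.
    pose proof (Cholo_cont _ _ (near_at _ _ hg)) as hc.
    refine (near_imp _ _ _ _ (near_and _ _ _ hk (hc e he))); intros y [k1 k2] hy.
    now rewrite <- gz, <- (k1 hy).
Qed.

(** * Passage to filters and to [good_boundary] *)

Lemma filterlim_C {T} (F : (T -> Prop) -> Prop) {FF : Filter F} (f : T -> C) (l : C) :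
  filterlim f F (locally l) <-> forall e, 0 < e -> F (fun x => Cmod (f x - l) < e).
Proof.
  split.
  - intros h e he; apply (h (fun w => Cmod (w - l) < e)).
    apply near_locally; now exists e.
  - intros h P hP; apply near_locally in hP; destruct hP as [d [hd k]].
    unfold filtermap; refine (filter_imp _ _ _ (h d hd)); auto.
Qed.

Lemma filterlim_Ccont {T} (F : (T -> Prop) -> Prop) {FF : Filter F} (f : T -> C) (l : C) G :
  filterlim f F (locally l) -> Ccont G l -> filterlim (fun x => G (f x)) F (locally (G l)).
Proof.
  intros hf hG; apply filterlim_C; [easy|]; intros e he.
  destruct (hG e he) as [d [hd k]].
  refine (filter_imp _ _ _ (proj1 (filterlim_C F f l) hf d hd)); auto.
Qed.

Lemma filterlim_Cminus {T} (F : (T -> Prop) -> Prop) {FF : Filter F} (f g : T -> C) (a b : C) :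
  filterlim f F (locally a) -> filterlim g F (locally b) ->
  filterlim (fun x => f x - g x)%C F (locally (a - b)%C).
Proof.
  intros hf hg; apply filterlim_C; [easy|]; intros e he.
  assert (h2 : 0 < e / 2) by lra.
  refine (filter_imp _ _ _ (filter_and _ _ (proj1 (filterlim_C F f a) hf _ h2)
                                           (proj1 (filterlim_C F g b) hg _ h2))).
  intros x [k1 k2].
  replace (f x - g x - (a - b))%C with ((f x - a) + - (g x - b))%C by ring.
  pose proof (Cmod_triangle (f x - a) (- (g x - b))) as t; rewrite Cmod_opp in t; lra.
Qed.

Lemma half_ext_affine up (h f : C -> C) (c : C) (b : R -> C) z : closed_half up z ->
  half_ext up (fun z => h z + c * f z)%C (fun x => h (RtoC x) + c * b x)%C z
  = (h z + c * half_ext up f b z)%C.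
Proof.
  unfold half_ext, closed_half; intros hz.
  assert (e : forall z : C, Im z = 0 -> RtoC (Re z) = z)
    by (intros w hw; apply injective_projections; [easy | symmetry; exact hw]).
  destruct up.
  - destruct (Rlt_dec 0 (Im z)); [easy|]; rewrite e by lra; easy.
  - destruct (Rlt_dec (Im z) 0); [easy|]; rewrite e by lra; easy.
Qed.

(** One statement serves both eigenvalues: mu+ has h = 0 and c = p, while mu- has h = tr T0 and c =
    -p. *)
Lemma good_boundary_affine A B dB dR up h c :
  1 <= A + B -> 1 <= B - A ->
  (forall x, (tau A B (RtoC x) * tau A B (RtoC x))%C = RtoC 1 -> Dset dB dR x) ->
  (forall z, Cholo h z) ->
  good_boundary dB dR up (fun z => h z + c * outer_root (tau A B z))%C
    (fun x => h (RtoC x) + c * boundary_root A B up x)%C.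
Proof.
  intros h1 h2 hD hh; split.
  - intros z hz; rewrite (half_ext_affine up h (fun z => outer_root (tau A B z)) c) by easy.
    fold (extended_root A B up).
    intros P hP; apply near_locally in hP.
    unfold filtermap, within; apply near_locally.
    destruct hP as [d [hd k]].
    set (G := fun w => (c * w)%C).
    assert (hG : Ccont G (extended_root A B up z))
      by (apply Ccont_mult; [apply Ccont_const | apply Ccont_id]).
    destruct (hG (d / 2) ltac:(lra)) as [d' [hd' k']].
    pose proof (Cholo_cont _ _ (hh z) (d / 2) ltac:(lra)) as n1.
    pose proof (extended_root_cont A B up z h1 h2 hz d' hd') as n2.
    refine (near_imp _ _ _ _ (near_and _ _ _ n1 n2)); intros y [k1 k2] hy; apply k.
    rewrite (half_ext_affine up h (fun z => outer_root (tau A B z)) c) by easy.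
    fold (extended_root A B up).
    specialize (k' _ (k2 hy)); unfold G in k'.
    set (u := extended_root A B up y) in *; set (v := extended_root A B up z) in *.
    replace (h y + c * u - (h z + c * v))%C with ((h y - h z) + (c * u - c * v))%C by ring.
    pose proof (Cmod_triangle (h y - h z) (c * u - c * v)); lra.
  - intros x hx.
    assert (hz : closed_half up (RtoC x)) by (destruct up; simpl; lra).
    destruct (extended_root_local A B up (RtoC x) h1 h2 hz) as [g [n1 n2]].
    { intros e; apply hx, hD, e. }
    destruct (near_and _ _ _ n1 n2) as [r [hr k]]; exists r; split; [easy|].
    exists (fun z => h z + c * g z)%C; split.
    + intros z hzr; apply Cholo_C_holo_at, Cholo_plus; [apply hh|].
      apply Cholo_scal, (k z hzr).
    + intros z hzr hzc.
      rewrite (half_ext_affine up h (fun z => outer_root (tau A B z)) c) by easy.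
      fold (extended_root A B up); f_equal; f_equal; now apply (k z hzr).
Qed.

Lemma good_boundary_limit dB dR up f b x : good_boundary dB dR up f b ->
  filterlim (fun e : R => f (RtoC x + Ci * RtoC (half_sign up * e))%C)
    (at_right 0) (locally (b x)).
Proof.
  intros [h _].
  assert (hx : closed_half up (RtoC x)) by (destruct up; simpl; lra).
  specialize (h _ hx).
  assert (e0 : half_ext up f b (RtoC x) = b x).
  { unfold half_ext; rewrite im_RtoC, re_RtoC; destruct up, (Rlt_dec 0 0); easy || lra. }
  rewrite e0 in h.
  intros P hP; specialize (h P hP); unfold filtermap, within in h.
  apply near_locally in h; destruct h as [d [hd k]].
  exists (mkposreal d hd); intros e he hpos.
  change (Rabs (e - 0) < d) in he; rewrite Rminus_0_r, Rabs_pos_eq in he by lra.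
  set (y := (RtoC x + Ci * RtoC (half_sign up * e))%C).
  assert (hi : Im y = half_sign up * e) by (simpl; ring).
  specialize (k y).
  replace (f y) with (half_ext up f b y).
  - apply k.
    + unfold y; replace (RtoC x + Ci * RtoC (half_sign up * e) - RtoC x)%C
        with (Ci * RtoC (half_sign up * e))%C by ring.
      rewrite Cmod_mult, Cmod_Ci, Cmod_R, Rmult_1_l.
      replace (Rabs (half_sign up * e)) with e; [easy|].
      unfold half_sign; destruct up; [rewrite Rabs_pos_eq | rewrite Rabs_left]; lra.
    + unfold closed_half, half_sign in *; destruct up; lra.
  - unfold half_ext; rewrite hi; unfold half_sign; destruct up, (Rlt_dec _ _); easy || lra.
Qed.

(** * Discreteness of the exceptional set *)

(** At a zero of the sine, sin (a + d) is sin d up to sign, nonzero for 0 < |d| < 1 < PI/2;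
    elsewhere continuity suffices. *)
Lemma sin_zeros_isolated a :
  exists r, 0 < r /\ forall d, 0 < Rabs d < r -> sin (a + d) <> 0.
Proof.
  destruct (Req_dec (sin a) 0) as [e|n].
  - exists 1; split; [lra|]; intros d hd; rewrite sin_plus, e.
    assert (hs : sin d <> 0).
    { pose proof PI2_1; unfold Rabs in hd; destruct (Rcase_abs d).
      - assert (0 < sin (- d)) by (apply sin_gt_0; lra); rewrite sin_neg in *; lra.
      - assert (0 < sin d) by (apply sin_gt_0; lra); lra. }
    destruct (sin_zero_cos a e) as [-> | ->]; lra.
  - destruct (continuity_sin a (Rabs (sin a))) as [r [hr k]]; [now apply Rabs_pos_lt|].
    exists r; split; [easy|]; intros d hd e; specialize (k (a + d)).
    assert (k' : Rabs (sin (a + d) - sin a) < Rabs (sin a)).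
    { apply k; split.
      - split; [easy|]; intros q; assert (d = 0) by lra; subst d; rewrite Rabs_R0 in hd; lra.
      - change (Rabs (a + d - a) < r); replace (a + d - a) with d by ring; lra. }
    rewrite e, Rminus_0_l, Rabs_Ropp in k'; lra.
Qed.

(** Two close points of the set share the same value 1 or -1 of tau, so cos (2 sqrt y) = cos (2 sqrt
    x). With d = sqrt y - sqrt x the product formula gives sin d = 0 or sin (2 sqrt x + d) = 0, and
    both are excluded for small nonzero d. *)
Lemma tau_sqr_1_isolated A B x : 1 <= A + B -> 1 <= B - A ->
  (tau A B (RtoC x) * tau A B (RtoC x))%C = RtoC 1 ->
  exists r, 0 < r /\ forall y, 0 < Rabs (y - x) < r ->
    (tau A B (RtoC y) * tau A B (RtoC y))%C <> RtoC 1.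
Proof.
  intros h1 h2 hx.
  assert (key : forall y, (tau A B (RtoC y) * tau A B (RtoC y))%C = RtoC 1 ->
    0 <= y /\ let T := A + B * cos (2 * sqrt y) in
    tau A B (RtoC y) = RtoC T /\ (T = 1 \/ T = -1)).
  { intros y hy.
    assert (hy0 : 0 <= y).
    { refine (proj2 (tau_in_cut A B (RtoC y) h1 h2 _)).
      replace (RtoC 1) with (RtoC 1 * RtoC 1)%C in hy by ring.
      apply Csqr_eq in hy; destruct hy as [-> | ->]; split; simpl; lra. }
    split; [easy|]; intros T; pose proof (tau_nonneg A B y hy0) as e; fold T in e.
    split; [easy|]; rewrite e, <- RtoC_mult in hy; apply RtoC_inj in hy.
    assert (k : (T - 1) * (T + 1) = 0) by lra; apply Rmult_integral in k; lra. }
  destruct (key x hx) as [hx0 [ex hTx]].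
  destruct (sin_zeros_isolated 0) as [r1 [hr1 k1]].
  destruct (sin_zeros_isolated (2 * sqrt x)) as [r2 [hr2 k2]].
  destruct (continuity_pt_sqrt x hx0 (Rmin r1 r2)) as [r3 [hr3 k3]]; [now apply Rmin_pos|].
  destruct (Cholo_cont _ _ (Cholo_tau A B (RtoC x)) 1 ltac:(lra)) as [r4 [hr4 k4]].
  exists (Rmin r3 r4); split; [now apply Rmin_pos|]; intros y hy hD.
  pose proof (Rmin_l r3 r4); pose proof (Rmin_r r3 r4).
  pose proof (Rmin_l r1 r2); pose proof (Rmin_r r1 r2).
  destruct (key y hD) as [hy0 [ey hTy]].
  assert (hne : y <> x).
  { intros ->; rewrite Rminus_diag, Rabs_R0 in hy; lra. }
  assert (hcl : Rabs ((A + B * cos (2 * sqrt y)) - (A + B * cos (2 * sqrt x))) < 1).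
  { rewrite <- Cmod_R, RtoC_minus, <- ex, <- ey; apply k4.
    rewrite <- RtoC_minus, Cmod_R; lra. }
  assert (ec : cos (2 * sqrt y) - cos (2 * sqrt x) = 0).
  { apply Rabs_def2 in hcl.
    assert (e : B * (cos (2 * sqrt y) - cos (2 * sqrt x)) = 0) by lra.
    apply Rmult_integral in e; lra. }
  assert (hd : Rabs (sqrt y - sqrt x) < Rmin r1 r2).
  { apply (k3 y); split; [split; [easy | congruence]|].
    change (Rabs (y - x) < r3); lra. }
  set (d := sqrt y - sqrt x) in *.
  assert (hd0 : 0 < Rabs d).
  { apply Rabs_pos_lt; unfold d; intros e; apply hne, sqrt_inj; lra. }
  rewrite form2 in ec.
  replace ((2 * sqrt y - 2 * sqrt x) / 2) with (0 + d) in ec by (unfold d; field).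
  replace ((2 * sqrt y + 2 * sqrt x) / 2) with (2 * sqrt x + d) in ec by (unfold d; field).
  specialize (k1 d ltac:(lra)); specialize (k2 d ltac:(lra)).
  apply Rmult_integral in ec; destruct ec as [ec|ec]; [|easy].
  apply Rmult_integral in ec; lra.
Qed.

(** * Asymptotics along the negative axis *)

Lemma exp_neg_sqrt_small e : 0 < e ->
  (* The bound -1/e^2 used below gives sqrt (-x) > 1/e, and then exp (2 sqrt (-x)) >= 1 + 2 sqrt
     (-x) > 1/e. *)
  Rbar_locally m_infty (fun x => x < 0 /\ exp (- (2 * sqrt (- x))) < e).
Proof.
  intros he; exists (- (/ e * / e)); intros x hx.
  assert (hi : 0 < / e) by now apply Rinv_0_lt_compat.
  split; [nra|].
  assert (k : / e < sqrt (- x)).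
  { rewrite <- (sqrt_square (/ e)) by lra; apply sqrt_lt_1_alt; nra. }
  rewrite exp_Ropp, <- (Rinv_inv e).
  apply Rinv_lt_contravar.
  - apply Rmult_lt_0_compat; [easy | apply exp_pos].
  - pose proof (exp_ineq1_le (2 * sqrt (- x))); lra.
Qed.

(** The other root 2 tau - W has modulus below 1, so with u = exp (-t), t = 2 sqrt (-x), the product
    u W differs from 2 u tau by less than u. Moreover 2 u (A + B cosh t) = B + u (2A + B u), which
    tends to B. *)
Lemma outer_root_tau_asymptotic A B : 1 <= A + B -> 1 <= B - A ->
  filterlim (fun x : R => RtoC (exp (- (2 * sqrt (- x)))) * outer_root (tau A B (RtoC x)))%C
    (Rbar_locally m_infty) (locally (RtoC B)).
Proof.
  intros h1 h2; apply filterlim_C; [apply Rbar_locally_filter|]; intros e he.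
  (* The total error is at most u (1 + 2|A| + B u), and u < 1. *)
  set (K := 1 + 2 * Rabs A + B).
  assert (hK : 0 < K) by (unfold K; pose proof (Rabs_pos A); lra).
  refine (filter_imp _ _ _ (filter_and _ _ (exp_neg_sqrt_small (e / K) _)
            (exp_neg_sqrt_small 1 Rlt_0_1))); [|now apply Rdiv_lt_0_compat].
  intros x [[hx hu] [_ hu1]].
  assert (hcut : ~ in_cut (tau A B (RtoC x))).
  { intros hc; apply tau_in_cut in hc; [|easy..]; simpl in hc; lra. }
  pose proof (outer_root_gt _ hcut) as hW.
  pose proof (conjugate_root_Cmod _ _ (outer_root_eq (tau A B (RtoC x)))) as hm.
  set (W := outer_root (tau A B (RtoC x))) in *.
  assert (hd : Cmod (RtoC 2 * tau A B (RtoC x) - W) < 1) by nra.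
  rewrite tau_neg in hd by easy.
  set (t := 2 * sqrt (- x)) in *; set (u := exp (- t)) in *.
  assert (hup : 0 < u) by apply exp_pos.
  assert (hc : u * (2 * cosh t) = 1 + u * u).
  { unfold cosh, u; transitivity (exp t * exp (- t) + exp (- t) * exp (- t)); [field|].
    rewrite <- exp_plus, Rplus_opp_r, exp_0; ring. }
  replace (RtoC u * W - RtoC B)%C with
    (- (RtoC u * (RtoC 2 * RtoC (A + B * cosh t) - W)) + RtoC (u * (2 * A + B * u)))%C.
  - pose proof (Cmod_triangle (- (RtoC u * (RtoC 2 * RtoC (A + B * cosh t) - W)))
      (RtoC (u * (2 * A + B * u)))) as T.
    rewrite Cmod_opp, Cmod_mult, !Cmod_R, (Rabs_mult u), (Rabs_pos_eq u) in T by lra.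
    assert (T2 : Rabs (2 * A + B * u) <= 2 * Rabs A + B).
    { pose proof (Rabs_triang (2 * A) (B * u)) as q.
      rewrite Rabs_mult, (Rabs_pos_eq 2), (Rabs_pos_eq (B * u)) in q by nra; nra. }
    assert (u * K < e) by (apply (Rlt_div_r u e K); lra).
    unfold K in *; nra.
  - rewrite <- RtoC_mult.
    replace (RtoC u * W - RtoC B)%C
      with (- (RtoC u * (RtoC (2 * (A + B * cosh t)) - W))
            + (RtoC u * RtoC (2 * (A + B * cosh t)) - RtoC B))%C by ring.
    f_equal; rewrite <- RtoC_mult, <- RtoC_minus; f_equal; nra.
Qed.

(** * The constants of T0 and the normalisation of its eigenvalues *)

Definition sqrt_det (dB dR : nat) : R := / sqrt (INR dR * INR dB).

(** This and [tau_amplitude] are the two constants of [tr_T0] divided by 2p, since tr T0 = 2 p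
    tau. *)
Definition tau_offset (dB dR : nat) : R :=
  (1 - / INR dR) * (1 - / INR dB) / (4 * sqrt_det dB dR).

Definition tau_amplitude (dB dR : nat) : R :=
  (1 + / INR dR) * (1 + / INR dB) / (4 * sqrt_det dB dR).

Definition tauT (dB dR : nat) : C -> C := tau (tau_offset dB dR) (tau_amplitude dB dR).

Lemma INR_ge_1 d : (1 <= d)%nat -> 1 <= INR d.
Proof. intros h; apply le_INR in h; simpl in h; lra. Qed.

Lemma sqrt_det_pos dB dR : (1 <= dB)%nat -> (1 <= dR)%nat -> 0 < sqrt_det dB dR.
Proof.
  intros hB hR; apply INR_ge_1 in hB, hR.
  apply Rinv_0_lt_compat, sqrt_lt_R0; nra.
Qed.

Lemma sqrt_det_sqr dB dR : (1 <= dB)%nat -> (1 <= dR)%nat ->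
  sqrt_det dB dR * sqrt_det dB dR = / INR dR * / INR dB.
Proof.
  intros hB hR; apply INR_ge_1 in hB, hR; unfold sqrt_det.
  rewrite <- Rinv_mult, sqrt_sqrt, Rinv_mult by nra; reflexivity.
Qed.

(** With a, b the reciprocals and p^2 = a b, one has A + B = (1 + p^2)/(2p) and B - A = (a +
    b)/(2p). Both are at least 1 by the inequality of arithmetic and geometric means. *)
Lemma tau_bounds dB dR : (1 <= dB)%nat -> (1 <= dR)%nat ->
  1 <= tau_offset dB dR + tau_amplitude dB dR /\
  1 <= tau_amplitude dB dR - tau_offset dB dR.
Proof.
  intros hB hR; pose proof (sqrt_det_pos dB dR hB hR) as hp.
  pose proof (sqrt_det_sqr dB dR hB hR) as hs.
  apply INR_ge_1 in hB, hR.
  assert (ha : 0 < / INR dB) by (apply Rinv_0_lt_compat; lra).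
  assert (hb : 0 < / INR dR) by (apply Rinv_0_lt_compat; lra).
  unfold tau_offset, tau_amplitude.
  set (p := sqrt_det dB dR) in *; set (a := / INR dB) in *; set (b := / INR dR) in *.
  split.
  - replace ((1 - b) * (1 - a) / (4 * p) + (1 + b) * (1 + a) / (4 * p))
      with ((1 + b * a) / (2 * p)) by (field; lra).
    apply Rle_div_r; [lra|].
    pose proof (Rle_0_sqr (p - 1)) as q; unfold Rsqr in q; lra.
  - replace ((1 + b) * (1 + a) / (4 * p) - (1 - b) * (1 - a) / (4 * p))
      with ((a + b) / (2 * p)) by (field; lra).
    apply Rle_div_r; [lra|]; apply Rsqr_incr_0_var; [unfold Rsqr | lra].
    pose proof (Rle_0_sqr (a - b)) as q; unfold Rsqr in q; lra.
Qed.

Lemma tr_T0_tauT dB dR l : (1 <= dB)%nat -> (1 <= dR)%nat ->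
  tr2 (T0 dB dR l) = (RtoC (2 * sqrt_det dB dR) * tauT dB dR l)%C.
Proof.
  intros hB hR; pose proof (sqrt_det_pos dB dR hB hR) as hp.
  rewrite tr_T0; unfold tauT, tau, tau_offset, tau_amplitude.
  set (p := sqrt_det dB dR) in *.
  replace ((1 - / INR dR) * (1 - / INR dB) / 2)
    with (2 * p * ((1 - / INR dR) * (1 - / INR dB) / (4 * p)))
    by (apply INR_ge_1 in hB, hR; field; lra).
  replace ((1 + / INR dR) * (1 + / INR dB) / 2)
    with (2 * p * ((1 + / INR dR) * (1 + / INR dB) / (4 * p)))
    by (apply INR_ge_1 in hB, hR; field; lra).
  rewrite (RtoC_mult (2 * p)), (RtoC_mult (2 * p)); ring.
Qed.

Lemma eigenvalue_T0 dB dR l w : (1 <= dB)%nat -> (1 <= dR)%nat ->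
  let t := tauT dB dR l in
  is_eigenvalue (T0 dB dR l) (RtoC (sqrt_det dB dR) * w) <->
  ((w - t) * (w - t))%C = (t * t - RtoC 1)%C.
Proof.
  intros hB hR t; pose proof (sqrt_det_pos dB dR hB hR) as hp.
  rewrite is_eigenvalue_charpoly, tr_T0_tauT, det_T0, <- sqrt_det_sqr by easy; fold t.
  set (p := sqrt_det dB dR) in *; rewrite !RtoC_mult.
  assert (hp0 : RtoC p <> RtoC 0) by (intros e; apply RtoC_inj in e; lra).
  assert (e : (RtoC p * w * (RtoC p * w) - RtoC 2 * RtoC p * t * (RtoC p * w) + RtoC p * RtoC p)%C
    = (RtoC p * RtoC p * ((w - t) * (w - t) - (t * t - RtoC 1)))%C) by ring.
  rewrite e; split.
  - intros h; apply Cmult_eq_0 in h; destruct h as [h|h].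
    + now apply Cmult_eq_0 in h; destruct h.
    + now apply Ceq_minus.
  - intros ->; ring.
Qed.

Lemma sigma1_in_cut dB dR l : (1 <= dB)%nat -> (1 <= dR)%nat ->
  sigma1 dB dR l <-> in_cut (tauT dB dR l).
Proof.
  intros hB hR; pose proof (sqrt_det_pos dB dR hB hR) as hp; unfold sigma1.
  fold (sqrt_det dB dR).
  assert (hp0 : RtoC (sqrt_det dB dR) <> RtoC 0)
    by (intros e; apply RtoC_inj in e; lra).
  split.
  - intros [mu [h1 h2]].
    replace mu with (RtoC (sqrt_det dB dR) * (mu / RtoC (sqrt_det dB dR)))%C in h1
      by (field; easy).
    apply eigenvalue_T0 in h1; [|easy..].
    apply unit_root_in_cut in h1; [easy|].
    rewrite Cmod_div, Cmod_R, Rabs_pos_eq, h2 by (easy || lra); field; lra.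
  - intros h; exists (RtoC (sqrt_det dB dR) * outer_root (tauT dB dR l))%C.
    pose proof (outer_root_eq (tauT dB dR l)) as e; split.
    + now apply eigenvalue_T0.
    + rewrite Cmod_mult, Cmod_R, Rabs_pos_eq, (in_cut_unit_root _ _ e h) by lra; ring.
Qed.

Lemma Dset_tauT dB dR x : (1 <= dB)%nat -> (1 <= dR)%nat ->
  Dset dB dR x <-> (tauT dB dR (RtoC x) * tauT dB dR (RtoC x))%C = RtoC 1.
Proof.
  intros hB hR; pose proof (sqrt_det_pos dB dR hB hR) as hp.
  pose proof (sqrt_det_sqr dB dR hB hR) as hs.
  unfold Dset; rewrite tr_T0_tauT by easy.
  set (p := sqrt_det dB dR) in *; set (t := tauT dB dR (RtoC x)).
  replace (4 / (INR dR * INR dB)) with (2 * p * (2 * p)).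
  2: { transitivity (4 * (p * p)); [ring|]; rewrite hs; unfold Rdiv; now rewrite Rinv_mult. }
  assert (hp0 : RtoC (2 * p) <> RtoC 0) by (intros e; apply RtoC_inj in e; lra).
  rewrite (RtoC_mult (2 * p)); set (c := RtoC (2 * p)) in *; split.
  - intros h; apply Ceq_minus.
    assert (e : (c * c * (t * t - RtoC 1))%C = RtoC 0)
      by (transitivity (c * t * (c * t) - c * c)%C; [ring | rewrite h; ring]).
    apply Cmult_eq_0 in e; destruct e as [e|e]; [|easy].
    now apply Cmult_eq_0 in e; destruct e.
  - intros h; transitivity (c * c * (t * t))%C; [ring | rewrite h; ring].
Qed.

(** * The jump across the cut *)

(** The two boundary values are conjugate: [half_sign] only flips the imaginary part. *)
Lemma boundary_root_jump A B x : in_cut (tau A B (RtoC x)) ->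
  (boundary_root A B true x - boundary_root A B false x)%C
  = (Ci * RtoC (2 * Im (boundary_root A B true x)))%C.
Proof.
  intros [_ h]; unfold boundary_root.
  destruct (Rle_dec _ _) as [k|k]; [|destruct k; now apply Rabs_le].
  apply injective_projections; simpl; ring.
Qed.

Lemma jump_of_boundary_values dB dR f bU bL (nu : C) : Im nu = 0 ->
  good_boundary dB dR true f bU -> good_boundary dB dR false f bL ->
  filterlim (fun e : R => (f (nu + Ci * RtoC e) - f (nu - Ci * RtoC e))%C)
    (at_right 0) (locally (bU (Re nu) - bL (Re nu))%C).
Proof.
  intros hi hU hL.
  assert (e : nu = RtoC (Re nu)) by (apply injective_projections; [easy | exact hi]).
  set (x := Re nu) in *; rewrite e.
  apply (filterlim_Cminus (at_right 0)).
  - apply (filterlim_ext (fun e : R => f (RtoC x + Ci * RtoC (half_sign true * e))%C)).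
    + intros y; simpl half_sign; now rewrite Rmult_1_l.
    + exact (good_boundary_limit _ _ _ _ _ x hU).
  - apply (filterlim_ext (fun e : R => f (RtoC x + Ci * RtoC (half_sign false * e))%C)).
    + intros y; simpl half_sign; f_equal.
      replace (-1 * y) with (- y) by ring; rewrite RtoC_opp; ring.
    + exact (good_boundary_limit _ _ _ _ _ x hL).
Qed.

Lemma affine_jump (h u v : C) (r : R) : Im h = 0 -> (u - v)%C = (Ci * RtoC (2 * Im u))%C ->
  ((h + RtoC r * u) - (h + RtoC r * v))%C = (Ci * RtoC (2 * Im (h + RtoC r * u)%C))%C.
Proof.
  intros hh e; change (Im (h + RtoC r * u)) with (Im h + Im (RtoC r * u)).
  rewrite hh, im_scal_l, Rplus_0_l.
  replace (2 * (r * Im u)) with (r * (2 * Im u)) by ring; rewrite RtoC_mult.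
  transitivity (RtoC r * (u - v))%C; [ring | rewrite e; ring].
Qed.

Theorem theorem4p3 (dB dR : nat) (hB : (1 <= dB)%nat) (hR : (1 <= dR)%nat) :
  (* sigma_1 is a subset of [0, oo) *)
  (forall l, sigma1 dB dR l -> Im l = 0 /\ 0 <= Re l) /\
  (* the set where (tr T0)^2 = 4/(dR dB) is discrete *)
  (forall x, Dset dB dR x -> exists r, 0 < r /\
     forall y, 0 < Rabs (y - x) < r -> ~ Dset dB dR y) /\
  exists (mup mum : C -> C) (bpU bpL bmU bmL : R -> C),
    (* mu^+, mu^- are eigenvalues of T0, analytic off sigma_1 *)
    (forall l, ~ sigma1 dB dR l ->
       is_eigenvalue (T0 dB dR l) (mup l) /\ is_eigenvalue (T0 dB dR l) (mum l) /\
       C_holo_at mup l /\ C_holo_at mum l /\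
       Cmod (mup l) > / sqrt (INR dR * INR dB) /\
       Cmod (mum l) < / sqrt (INR dR * INR dB)) /\
    (* asymptotics as lambda -> -oo along the real axis *)
    filterlim (fun x : R => (RtoC (exp (- (2 * Rabs (Im (Csqrt (RtoC x)))))) * mup (RtoC x))%C)
      (Rbar_locally m_infty)
      (locally (RtoC ((INR dR + 1) / (2 * INR dR) * ((INR dB + 1) / (2 * INR dB))))) /\
    filterlim (fun x : R => (RtoC (exp (2 * Rabs (Im (Csqrt (RtoC x))))) * mum (RtoC x))%C)
      (Rbar_locally m_infty)
      (locally (RtoC (2 / (INR dR + 1) * (2 / (INR dB + 1))))) /\
    (* continuous extensions from the upper / lower half planes,
       analytic except on Dset *)
    good_boundary dB dR true mup bpU /\ good_boundary dB dR false mup bpL /\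
    good_boundary dB dR true mum bmU /\ good_boundary dB dR false mum bmL /\
    (* jump across sigma_1 *)
    (forall nu, sigma1 dB dR nu ->
       filterlim (fun e : R => (mup (nu + Ci * RtoC e) - mup (nu - Ci * RtoC e))%C)
         (at_right 0) (locally (Ci * RtoC (2 * Im (bpU (Re nu))))%C) /\
       filterlim (fun e : R => (mum (nu + Ci * RtoC e) - mum (nu - Ci * RtoC e))%C)
         (at_right 0) (locally (Ci * RtoC (2 * Im (bmU (Re nu))))%C)).
Proof.
  destruct (tau_bounds dB dR hB hR) as [h1 h2].
  pose proof (sqrt_det_pos dB dR hB hR) as hp.
  pose proof (sqrt_det_sqr dB dR hB hR) as hs.
  assert (hsig : forall l, sigma1 dB dR l -> Im l = 0 /\ 0 <= Re l).
  { intros l hl; apply sigma1_in_cut in hl; [|easy..]; revert hl; now apply tau_in_cut. }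
  split; [exact hsig|split].
  { intros x hx; apply Dset_tauT in hx; [|easy..].
    destruct (tau_sqr_1_isolated _ _ x h1 h2 hx) as [r [hr k]].
    exists r; split; [easy|]; intros y hy hD; apply Dset_tauT in hD; [|easy..].
    exact (k y hy hD). }
  assert (hD : forall x, (tauT dB dR (RtoC x) * tauT dB dR (RtoC x))%C = RtoC 1 -> Dset dB dR x)
    by (intros x; now apply Dset_tauT).
  assert (hcut : forall l, sigma1 dB dR l <-> in_cut (tauT dB dR l))
    by (intros l; now apply sigma1_in_cut).
  pose proof (outer_root_tau_asymptotic _ _ h1 h2) as hlim; fold (tauT dB dR) in hlim.
  fold (sqrt_det dB dR); set (p := sqrt_det dB dR) in *.
  assert (hpB : p * tau_amplitude dB dR
    = (INR dR + 1) / (2 * INR dR) * ((INR dB + 1) / (2 * INR dB))).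
  { unfold tau_amplitude; fold p; apply INR_ge_1 in hB, hR; field; lra. }
  (* The limit of mu- is p/B, as mu+ mu- = p^2 and mu+ grows like p B times the exponential. *)
  assert (hBp : p * / tau_amplitude dB dR = 2 / (INR dR + 1) * (2 / (INR dB + 1))).
  { unfold tau_amplitude; fold p; apply INR_ge_1 in hB, hR.
    transitivity (4 * (p * p) / ((1 + / INR dR) * (1 + / INR dB))).
    - field; repeat split; try lra; nra.
    - rewrite hs; field; repeat split; try lra; nra. }
  set (A := tau_offset dB dR) in *; set (B := tau_amplitude dB dR) in *.
  set (t := tauT dB dR) in *.
  assert (hholo : forall z, Cholo (fun y => RtoC (2 * p) * t y)%C z)
    by (intros; apply Cholo_scal, Cholo_tau).
  (* The zero summand puts mu+ in the affine shape shared with mu-. *)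
  set (f0 := fun _ : C => RtoC 0).
  set (ft := fun z => (RtoC (2 * p) * t z)%C).
  pose proof (fun up => good_boundary_affine A B dB dR up f0 (RtoC p) h1 h2 hD
                          (Cholo_const _)) as gp.
  pose proof (fun up => good_boundary_affine A B dB dR up ft (RtoC (- p)) h1 h2 hD hholo) as gm.
  exists (fun z => f0 z + RtoC p * outer_root (t z))%C.
  exists (fun z => ft z + RtoC (- p) * outer_root (t z))%C.
  exists (fun x => f0 (RtoC x) + RtoC p * boundary_root A B true x)%C.
  exists (fun x => f0 (RtoC x) + RtoC p * boundary_root A B false x)%C.
  exists (fun x => ft (RtoC x) + RtoC (- p) * boundary_root A B true x)%C.
  exists (fun x => ft (RtoC x) + RtoC (- p) * boundary_root A B false x)%C.
  assert (emup : forall z, (f0 z + RtoC p * outer_root (t z))%C = (RtoC p * outer_root (t z))%C)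
    by (intros; unfold f0; ring).
  assert (emum : forall z, (ft z + RtoC (- p) * outer_root (t z))%C
    = (RtoC p * (RtoC 2 * t z - outer_root (t z)))%C)
    by (intros; unfold ft; rewrite RtoC_mult, RtoC_opp; ring).
  split; [|split; [|split; [|split; [|split; [|split; [|split]]]]]];
    [| | | apply gp | apply gp | apply gm | apply gm |].
  - intros l hl; rewrite hcut in hl.
    pose proof (outer_root_eq (t l)) as hw.
    pose proof (outer_root_gt _ hl) as hgt.
    pose proof (conjugate_root_Cmod _ _ hw) as hprod.
    pose proof (proj1 (near_at _ _ (Cholo_outer_root t l (Cholo_tau A B) hl))) as hol.
    rewrite emup, emum, !Cmod_mult, !Cmod_R, !Rabs_pos_eq by lra.
    repeat split.
    + now apply eigenvalue_T0.
    + apply eigenvalue_T0; [easy..|]; fold t; rewrite <- hw; ring.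
    + apply Cholo_C_holo_at, Cholo_plus; [apply Cholo_const | now apply Cholo_scal].
    + apply Cholo_C_holo_at, Cholo_plus; [apply hholo | now apply Cholo_scal].
    + nra.
    + assert (Cmod (RtoC 2 * t l - outer_root (t l)) < 1) by nra; nra.
  - rewrite <- hpB, RtoC_mult.
    apply (filterlim_ext_loc
      (fun x : R => RtoC p * (RtoC (exp (- (2 * sqrt (- x)))) * outer_root (t (RtoC x))))%C).
    + refine (filter_imp _ _ _ (exp_neg_sqrt_small 1 Rlt_0_1)); intros x [hx _].
      rewrite emup, Csqrt_neg by easy; simpl Im; rewrite Rabs_pos_eq by apply sqrt_pos; ring.
    + apply (filterlim_Ccont _ _ _ (fun w => RtoC p * w)%C hlim).
      apply Ccont_mult; [apply Ccont_const | apply Ccont_id].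
  - rewrite <- hBp, RtoC_mult, RtoC_inv by lra.
    apply (filterlim_ext_loc
      (fun x : R => RtoC p * / (RtoC (exp (- (2 * sqrt (- x)))) * outer_root (t (RtoC x))))%C).
    + refine (filter_imp _ _ _ (exp_neg_sqrt_small 1 Rlt_0_1)); intros x [hx _].
      rewrite emum, Csqrt_neg by easy; simpl Im; rewrite Rabs_pos_eq by apply sqrt_pos.
      pose proof (conjugate_root_product _ _ (outer_root_eq (t (RtoC x)))) as hprod.
      set (W := outer_root (t (RtoC x))) in *; set (s := 2 * sqrt (- x)).
      assert (hW : W <> RtoC 0).
      { intros e; rewrite e, Cmult_0_l in hprod; apply RtoC_inj in hprod; lra. }
      assert (hE : (RtoC (exp s) * RtoC (exp (- s)))%C = RtoC 1)
        by (now rewrite <- RtoC_mult, <- exp_plus, Rplus_opp_r, exp_0).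
      assert (hE0 : RtoC (exp (- s)) <> RtoC 0)
        by (intros e; apply RtoC_inj in e; pose proof (exp_pos (- s)); lra).
      transitivity (RtoC p * / (RtoC (exp (- s)) * W)
        * ((RtoC (exp s) * RtoC (exp (- s))) * (W * (RtoC 2 * t (RtoC x) - W))))%C.
      * rewrite hE, hprod; ring.
      * field; split; assumption.
    + apply (filterlim_Ccont _ _ _ (fun w => RtoC p * / w)%C hlim).
      apply Ccont_mult; [apply Ccont_const|]; apply Ccont_inv.
      intros e; apply RtoC_inj in e; lra.
  - intros nu hnu.
    destruct (hsig nu hnu) as [hi _].
    assert (e : nu = RtoC (Re nu)) by (apply injective_projections; [easy | exact hi]).
    apply hcut in hnu; rewrite e in hnu.
    pose proof (boundary_root_jump A B (Re nu) hnu) as hj.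
    assert (et : Im (t (RtoC (Re nu))) = 0) by (unfold t, tauT; rewrite tau_real; apply im_RtoC).
    split.
    + rewrite <- (affine_jump (f0 (RtoC (Re nu))) _ (boundary_root A B false (Re nu)))
        by (reflexivity || exact hj).
      exact (jump_of_boundary_values dB dR _ _ _ nu hi (gp true) (gp false)).
    + rewrite <- (affine_jump (ft (RtoC (Re nu))) _ (boundary_root A B false (Re nu)))
        by (exact hj || (unfold ft; rewrite im_scal_l, et; ring)).
      exact (jump_of_boundary_values dB dR _ _ _ nu hi (gm true) (gm false)).
Qed.
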